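(* Let $R$ be a chain ring. The following assertions hold: (1) $\widetilde{R}$ is a local Gaussian ring; (2) the following conditions are equivalent: (a) $\widetilde{R}$ is a chain ring; (b) $R$ is either complete (in its f.c. topology) or a domain; (c) $\widetilde{R}$ is a pure $R$-submodule of $\widehat{R}$; (d) $\widetilde{R}$ is a flat $R$-module.
   Context: All rings are commutative with unity and all modules are unital. A chain ring is a ring whose ideals are totally ordered by inclusion; $P$ denotes the maximal ideal of $R$. A module is finitely cogenerated if its injective hull is a finite direct sum of injective hulls of simple modules. The f.c. topology on a module $M$ is the linear topology with basis of neighbourhoods of $0$ the submodules $G$ such that $M/G$ is finitely cogenerated (it is always Hausdorff); $\widetilde{M}$ is the completion of $M$ in this topology, and $\widetilde{R}$ is a ring. A submodule $F$ of $E$ is pure if $0\to F\to E\to E/F\to 0$ remains exact after tensoring with any module. $\widehat{M}$ is the pure-injective hull of $M$: a pure-injective module (injective relative to pure exact sequences) containing $M$ as a pure submodule and pure-essential over $M$ (for each submodule $K\ne 0$ of $\widehat M$, either $K\cap M\neq 0$ or $(M+K)/K$ is not pure in $\widehat M/K$); it exists and is unique up to isomorphism. $\widetilde{R}$ is regarded as an $R$-submodule of $\widehat{R}$ as follows: if $R$ is finitely cogenerated as a module over itself, $\widetilde{R}=R$; otherwise an element $a\in\widetilde{R}$ is given by a compatible family of cosets $(a_r+rP)_{0\neq r\in R}$, and it is identified with the unique element of $\bigcap_{0\ne r\in R}(a_r+rP\widehat{R})$ in $\widehat{R}$. A local ring $R$ is called Gaussian if for any ideal $A$ generated by two elements $a,b$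 of $R$: (i) $A^2$ is generated by $a^2$ or by $b^2$; and (ii) if $A^2$ is generated by $a^2$ and $ab=0$, then $b^2=0$. *)

(* Defs.v *)
From HB Require Import structures.
From mathcomp Require Import all_boot all_algebra.
From mathcomp Require Import boolp classical_sets.

Set Implicit Arguments.
Unset Strict Implicit.
Unset Printing Implicit Defensive.

Import GRing.Theory.

Local Open Scope ring_scope.
Local Open Scope quotient_scope.

(** Submodules of [M] are the inhabitants of MathComp's [submodClosed M];
    ideals of [R] are the submodules of the regular module [R^o]. *)
Notation ideal R := (submodClosed R^o).

Section Submodules.
Variables (R : comPzRingType).

Section OfSubmodule.
Variables (M : lmodType R) (G : submodClosed M).

Record submod : Type := Submod { submod_val : M; submod_valP : submod_val \in G }.

HB.instance Definition _ := [isSub for submod_val].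
HB.instance Definition _ := [Choice of submod by <:].
HB.instance Definition _ := [SubChoice_isSubLmodule of submod by <:].

Fact submod_val_linear : linear submod_val.
Proof. exact: (linearP (val : {linear submod -> M})). Qed.

HB.instance Definition _ :=
  GRing.isLinear.Build R submod M _ submod_val submod_val_linear.

Definition submod_incl : {linear submod -> M} := submod_val.

Lemma submodN x : (- x \in G) = (x \in G).
Proof.
by apply/idP/idP => Gx; [rewrite -[x]opprK|]; rewrite -scaleN1r rpredZ.
Qed.

(** [submodClosed] only provides an [addrClosed] structure; quotients need a
    [zmodClosed] one. *)
Definition submod_pred : {pred M} := fun x => x \in G.

Lemma submod_pred_zmod : zmod_closed submod_pred.
Proof.
by split=> [|x y Gx Gy]; rewrite /submod_pred unfold_in ?rpred0 // rpredD ?submodN.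
Qed.

HB.instance Definition _ := GRing.isZmodClosed.Build M submod_pred
  submod_pred_zmod.

Definition quotmod : Type := Quotient.quot submod_pred.

HB.instance Definition _ := GRing.Zmodule.on quotmod.
HB.instance Definition _ := Quotient.on quotmod.

Definition quot_scale (a : R) (x : quotmod) : quotmod :=
  \pi_quotmod (a *: repr x).

Lemma quot_piP (x y : M) : (\pi_quotmod x = \pi_quotmod y) <-> (x - y \in G).
Proof.
have e := Quotient.idealrBE submod_pred x y; rewrite /= unfold_in in e.
by split=> [/eqP|xy]; [rewrite -e | apply/eqP; rewrite -e].
Qed.

Lemma quot_reprB (x : M) : repr (\pi_quotmod x) - x \in G.
Proof. by apply/quot_piP; rewrite reprK. Qed.

Lemma pi_quotD (x y : M) :
  \pi_quotmod (x + y) = \pi_quotmod x + \pi_quotmod y.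
Proof. exact: (@Quotient.pi_add M submod_pred). Qed.

Lemma pi_quotZ (a : R) (x : M) :
  \pi_quotmod (a *: x) = quot_scale a (\pi_quotmod x).
Proof.
by apply/esym/quot_piP; rewrite -scalerBr rpredZ // quot_reprB.
Qed.

Lemma quot_scaleA a b x : quot_scale a (quot_scale b x) = quot_scale (a * b) x.
Proof. by rewrite -[x]reprK -(pi_quotZ b) -!pi_quotZ scalerA. Qed.

Lemma quot_scale1 : left_id 1 quot_scale.
Proof. by move=> x; rewrite -[x]reprK -!pi_quotZ scale1r. Qed.

Lemma quot_scaleDr : right_distributive quot_scale +%R.
Proof.
move=> a x y; rewrite -[x]reprK -[y]reprK -pi_quotD -!pi_quotZ.
by rewrite scalerDr pi_quotD.
Qed.

Lemma quot_scaleDl v : {morph quot_scale^~ v : a b / a + b}.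
Proof. by move=> a b; rewrite -[v]reprK -!pi_quotZ scalerDl pi_quotD. Qed.

HB.instance Definition _ := GRing.Zmodule_isLmodule.Build R quotmod
  quot_scaleA quot_scale1 quot_scaleDr quot_scaleDl.

Definition quot_proj_fun (x : M) : quotmod := \pi_quotmod x.

Lemma quot_proj_is_linear : linear quot_proj_fun.
Proof. by move=> a x y; rewrite /quot_proj_fun pi_quotD pi_quotZ. Qed.

HB.instance Definition _ :=
  GRing.isLinear.Build R M quotmod _ quot_proj_fun quot_proj_is_linear.

Definition quot_proj : {linear M -> quotmod} := quot_proj_fun.

End OfSubmodule.

Definition linear_range (M N : lmodType R) (f : {linear M -> N}) : {pred N} :=
  fun y => `[< exists x, f x = y >].

Lemma linear_range_closed (M N : lmodType R) (f : {linear M -> N}) :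
  submod_closed (linear_range f).
Proof.
split=> [|a y z /asboolP[u <-] /asboolP[v <-]].
  by apply/asboolP; exists 0; rewrite linear0.
by apply/asboolP; exists (a *: u + v); rewrite linearP.
Qed.

HB.instance Definition _ (M N : lmodType R) (f : {linear M -> N}) :=
  GRing.isSubmodClosed.Build R N (linear_range f) (linear_range_closed f).

Definition generated (M : lmodType R) (X : set M) : {pred M} :=
  fun x => `[< forall N : submodClosed M,
                 (forall y, X y -> y \in N) -> x \in N >].

Lemma generated_closed (M : lmodType R) (X : set M) :
  submod_closed (generated X).
Proof.
split=> [|a y z /asboolP Xy /asboolP Xz]; apply/asboolP=> N XN.
  exact: rpred0.
by rewrite rpredD ?rpredZ ?Xy ?Xz.
Qed.

HB.instance Definition _ (M : lmodType R) (X : set M) :=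
  GRing.isSubmodClosed.Build R M (generated X) (generated_closed X).

End Submodules.

Section TensorProduct.
Variables (R : comPzRingType) (M N : lmodType R).

(** [tensor M N] is the commutative monoid of formal sums of pairs modulo the
    congruence generated by the bilinearity relations; the relations make
    [(- x, y)] inverse to [(x, y)]. *)
Inductive tensor_rel : seq (M * N) -> seq (M * N) -> Prop :=
| tensor_refl s : tensor_rel s s
| tensor_sym s t : tensor_rel s t -> tensor_rel t s
| tensor_trans s t u : tensor_rel s t -> tensor_rel t u -> tensor_rel s u
| tensor_cat s s' t t' :
    tensor_rel s s' -> tensor_rel t t' -> tensor_rel (s ++ t) (s' ++ t')
| tensor_catC s t : tensor_rel (s ++ t) (t ++ s)
| tensor_zero : tensor_rel [:: (0, 0)] [::]
| tensor_addl x x' y : tensor_rel [:: (x + x', y)] [:: (x, y); (x', y)]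
| tensor_addr x y y' : tensor_rel [:: (x, y + y')] [:: (x, y); (x, y')]
| tensor_scale a x y : tensor_rel [:: (a *: x, y)] [:: (x, a *: y)].

Definition tensor_eqv : rel (seq (M * N)) := fun s t => `[< tensor_rel s t >].

Lemma tensor_eqv_equiv : equiv_class_of tensor_eqv.
Proof.
split=> [s|s t|t s u /asboolP st /asboolP tu].
- by apply/asboolP; exact: tensor_refl.
- by apply/asboolP/asboolP; exact: tensor_sym.
- by apply/asboolP; exact: tensor_trans st tu.
Qed.

Canonical tensor_equiv := EquivRelPack tensor_eqv_equiv.
Canonical tensor_encModRel := defaultEncModRel tensor_eqv.

Definition tensor : Type := {eq_quot tensor_eqv}.

HB.instance Definition _ : EqQuotient _ tensor_eqv tensor :=
  EqQuotient.on tensor.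
HB.instance Definition _ := Choice.on tensor.

Lemma tensor_piP s t : (\pi_tensor s = \pi_tensor t) <-> tensor_rel s t.
Proof.
split=> [/eqmodP /asboolP //|st].
by apply/eqmodP/asboolP.
Qed.

Lemma tensor_repr s : tensor_rel (repr (\pi_tensor s)) s.
Proof. by apply/tensor_piP; rewrite reprK. Qed.

Definition tensor_add (t u : tensor) : tensor := \pi_tensor (repr t ++ repr u).
Definition tensor_scal (a : R) (t : tensor) : tensor :=
  \pi_tensor [seq (a *: p.1, p.2) | p <- repr t].
Definition tensor_opp (t : tensor) : tensor := tensor_scal (-1) t.

Lemma pi_tensor_add s t :
  tensor_add (\pi_tensor s) (\pi_tensor t) = \pi_tensor (s ++ t).
Proof. by apply/tensor_piP; apply: tensor_cat; apply: tensor_repr. Qed.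

Lemma tensor_rel_scal a s t : tensor_rel s t ->
  tensor_rel [seq (a *: p.1, p.2) | p <- s] [seq (a *: p.1, p.2) | p <- t].
Proof.
elim=> {s t} [s|s t _|s t u _ st _|s s' t t' _ ss' _ tt'|s t||x x' y|x y y'|
              b x y] /=.
- exact: tensor_refl.
- exact: tensor_sym.
- exact: tensor_trans st.
- by rewrite !map_cat; apply: tensor_cat.
- by rewrite !map_cat; apply: tensor_catC.
- by rewrite scaler0; apply: tensor_zero.
- by rewrite scalerDr; apply: tensor_addl.
- exact: tensor_addr.
- by rewrite scalerA mulrC -scalerA; apply: tensor_scale.
Qed.

Lemma pi_tensor_scal a s : tensor_scal a (\pi_tensor s) =
  \pi_tensor [seq (a *: p.1, p.2) | p <- s].
Proof.
by apply/tensor_piP; apply: tensor_rel_scal; apply: tensor_repr.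
Qed.

Lemma tensor_rel0 y : tensor_rel [:: (0, y)] [::].
Proof.
apply: tensor_trans tensor_zero; rewrite -{1}(scale0r (0 : M)).
by rewrite -(scale0r y); apply: tensor_scale.
Qed.

Lemma tensor_addA : associative tensor_add.
Proof.
move=> x y z; rewrite -[x]reprK -[y]reprK -[z]reprK.
by rewrite (pi_tensor_add (repr y)) (pi_tensor_add (repr x) (repr y)) !pi_tensor_add catA.
Qed.

Lemma tensor_addC : commutative tensor_add.
Proof. by move=> x y; apply/tensor_piP; apply: tensor_catC. Qed.

Lemma tensor_add0 : left_id (\pi_tensor [::]) tensor_add.
Proof. by move=> x; rewrite -[x]reprK pi_tensor_add. Qed.

Lemma tensor_scalDl t : {morph tensor_scal^~ t : a b / a + b >-> tensor_add a b}.
Proof.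
move=> a b; rewrite -[t]reprK !pi_tensor_scal pi_tensor_add; apply/tensor_piP.
elim: (repr t) => [|[x y] s IHs] /=; first exact: tensor_refl.
rewrite scalerDl.
have h1 := tensor_cat (tensor_addl (a *: x) (b *: x) y) IHs.
apply: tensor_trans h1 _ => /=.
rewrite -cat1s -[X in tensor_rel _ X]cat1s; apply: tensor_cat.
  exact: tensor_refl.
rewrite -cat1s -[X in tensor_rel _ (_ ++ X)]cat1s !catA; apply: tensor_cat.
  exact: tensor_catC.
exact: tensor_refl.
Qed.

Lemma tensor_scal0 t : tensor_scal 0 t = \pi_tensor [::].
Proof.
rewrite -[t]reprK pi_tensor_scal; apply/tensor_piP.
elim: (repr t) => [|[x y] s IHs] /=; first exact: tensor_refl.
by rewrite scale0r; have := tensor_cat (tensor_rel0 y) IHs.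
Qed.

Lemma tensor_scal1 : left_id 1 tensor_scal.
Proof.
move=> t; rewrite -[t]reprK pi_tensor_scal; congr (\pi_tensor _).
by rewrite -[RHS]map_id; apply: eq_map => -[x y] /=; rewrite scale1r.
Qed.

Lemma tensor_addN : left_inverse (\pi_tensor [::]) tensor_opp tensor_add.
Proof.
move=> t; rewrite /tensor_opp -{2}[t]tensor_scal1 -tensor_scalDl.
by rewrite addNr tensor_scal0.
Qed.

HB.instance Definition _ := GRing.isZmodule.Build tensor
  tensor_addA tensor_addC tensor_add0 tensor_addN.

Lemma tensor_scalA a b t :
  tensor_scal a (tensor_scal b t) = tensor_scal (a * b) t.
Proof.
rewrite -[t]reprK (pi_tensor_scal b) !pi_tensor_scal -map_comp; congr (\pi_tensor _).
by apply: eq_map => -[x y] /=; rewrite scalerA.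
Qed.

Lemma tensor_scalDr : right_distributive tensor_scal +%R.
Proof.
move=> a t u; rewrite -[t]reprK -[u]reprK /GRing.add /=.
by rewrite pi_tensor_add !pi_tensor_scal pi_tensor_add map_cat.
Qed.

HB.instance Definition _ := GRing.Zmodule_isLmodule.Build R tensor
  tensor_scalA tensor_scal1 tensor_scalDr tensor_scalDl.

End TensorProduct.

Section TensorMap.
Variables (R : comPzRingType) (M M' N N' : lmodType R).
Variables (f : {linear M -> M'}) (g : {linear N -> N'}).

Definition tensor_map (t : tensor M N) : tensor M' N' :=
  \pi_(tensor M' N') [seq (f p.1, g p.2) | p <- repr t].

Lemma tensor_rel_map (s t : seq (M * N)) : tensor_rel s t ->
  tensor_rel [seq (f p.1, g p.2) | p <- s] [seq (f p.1, g p.2) | p <- t].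
Proof.
elim=> {s t} [s|s t _|s t u _ st _|
  s s' t t' _ ss' _ tt'|s t||x x' y|x y y'|b x y] /=.
- exact: tensor_refl.
- exact: tensor_sym.
- exact: tensor_trans st.
- by rewrite !map_cat; apply: tensor_cat.
- by rewrite !map_cat; apply: tensor_catC.
- by rewrite !linear0; apply: tensor_zero.
- by rewrite linearD; apply: tensor_addl.
- by rewrite linearD; apply: tensor_addr.
- by rewrite !linearZ; apply: tensor_scale.
Qed.

Lemma pi_tensor_map s : tensor_map (\pi_(tensor M N) s) =
  \pi_(tensor M' N') [seq (f p.1, g p.2) | p <- s].
Proof. by apply/tensor_piP; apply: tensor_rel_map; apply: tensor_repr. Qed.

End TensorMap.

Section HomologicalNotions.
Variable R : comPzRingType.
Implicit Types M N E F : lmodType R.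

Definition short_exact (A B C : zmodType) (f : A -> B) (g : B -> C) : Prop :=
  [/\ injective f, forall y, g y = 0 <-> exists x, f x = y
    & forall z, exists y, g y = z].

Definition pure_submodule E (F : submodClosed E) : Prop :=
  forall N, short_exact (tensor_map (submod_incl F) (@idfun N))
                        (tensor_map (quot_proj F) (@idfun N)).

Definition flat N : Prop :=
  forall (A B : lmodType R) (f : {linear A -> B}),
    injective f -> injective (tensor_map f (@idfun N)).

Definition injective_module E : Prop :=
  forall (A B : lmodType R) (i : {linear A -> B}) (f : {linear A -> E}),
    injective i -> exists g : {linear B -> E}, forall x, g (i x) = f x.

Definition pure_injective E : Prop :=
  forall (B : lmodType R) (A : submodClosed B) (f : {linear submod A -> E}),
    pure_submodule A ->
    exists g : {linear B -> E}, forall x, g (submod_incl A x) = f x.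

Definition nonzero_submodule M (K : submodClosed M) : Prop :=
  exists2 x, x \in K & x != 0.

Definition meets_range M E (j : {linear M -> E}) (K : submodClosed E) : Prop :=
  exists2 x, x \in K & x != 0 /\ x \in linear_range j.

Definition injective_hull M E (j : {linear M -> E}) : Prop :=
  [/\ injective j, injective_module E
    & forall K : submodClosed E, nonzero_submodule K -> meets_range j K].

(** The submodule [(M + K) / K] of [E / K] is the range of
    [M -> E -> E / K]. *)
Definition pure_injective_hull M E (j : {linear M -> E}) : Prop :=
  [/\ injective j, pure_submodule (linear_range j), pure_injective E
    & forall K : submodClosed E, nonzero_submodule K ->
        meets_range j K \/
        ~ pure_submodule (linear_range (quot_proj K \o j))].

Definition simple_module M : Prop :=
  (exists x : M, x != 0) /\
  forall K : submodClosed M, nonzero_submodule K -> forall x, x \in K.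

(** [E] is the direct sum of the [F i] along the maps [u i]. *)
Definition is_direct_sum n (F : 'I_n -> lmodType R) E
    (u : forall i, {linear F i -> E}) : Prop :=
  bijective (fun x : forall i, F i => \sum_(i < n) u i (x i)).

Definition finitely_cogenerated M : Prop :=
  exists (E : lmodType R) (j : {linear M -> E}),
    injective_hull j /\
    exists (n : nat) (S F : 'I_n -> lmodType R)
           (h : forall i, {linear S i -> F i})
           (u : forall i, {linear F i -> E}),
      (forall i, simple_module (S i) /\ injective_hull (h i)) /\
      is_direct_sum u.

End HomologicalNotions.

Section Completion.
Variables (R : comPzRingType) (M : lmodType R).

Record fc_open : Type := FcOpen {
  fc_open_sub :> submodClosed M;
  fc_openP : finitely_cogenerated (quotmod fc_open_sub)
}.

(** The completion of [M] in the f.c. topology is the inverse limit of the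
    quotients [M / G], [G] running over the submodules with [M / G] finitely
    cogenerated; a point is a compatible family of cosets. *)
Record fc_completion : Type := FcCompletion {
  fc_coord : forall G : fc_open, quotmod G;
  fc_coordP : forall (G H : fc_open) (x : M), {subset G <= H} ->
    fc_coord G = quot_proj G x -> fc_coord H = quot_proj H x
}.

HB.instance Definition _ := gen_eqMixin fc_completion.
HB.instance Definition _ := gen_choiceMixin fc_completion.

Lemma fc_completion_eq (a b : fc_completion) :
  (forall G, fc_coord a G = fc_coord b G) -> a = b.
Proof.
case: a b => [a aP] [b bP] /= ab.
have {}ab : a = b by apply: functional_extensionality_dep.
by case: _ / ab bP => bP; congr FcCompletion; apply: Prop_irrelevance.
Qed.

Lemma quot_projP (G : submodClosed M) (x : quotmod G) :
  exists y, x = quot_proj G y.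
Proof. by exists (repr x); rewrite /= /quot_proj_fun reprK. Qed.

Lemma quot_proj_sub (G H : submodClosed M) x y : {subset G <= H} ->
  quot_proj G x = quot_proj G y -> quot_proj H x = quot_proj H y.
Proof. by move=> GH /quot_piP xy; apply/quot_piP/GH. Qed.

Fact fc_constP x (G H : fc_open) (y : M) : {subset G <= H} ->
  quot_proj G x = quot_proj G y -> quot_proj H x = quot_proj H y.
Proof. exact: quot_proj_sub. Qed.

Definition fc_const (x : M) : fc_completion := FcCompletion (@fc_constP x).

Fact fc_linP (r : R) (a b : fc_completion) (G H : fc_open) (x : M) :
  {subset G <= H} -> r *: fc_coord a G + fc_coord b G = quot_proj G x ->
  r *: fc_coord a H + fc_coord b H = quot_proj H x.
Proof.
move=> GH; have [y ay] := quot_projP (fc_coord a G).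
have [z bz] := quot_projP (fc_coord b G).
rewrite ay bz (fc_coordP GH ay) (fc_coordP GH bz) -!linearP.
exact: quot_proj_sub.
Qed.

Definition fc_lin r a b : fc_completion := FcCompletion (@fc_linP r a b).

Definition fc_zero := fc_const 0.
Definition fc_add a b := fc_lin 1 a b.
Definition fc_opp a := fc_lin (-1) a fc_zero.
Definition fc_scale r a := fc_lin r a fc_zero.

Lemma fc_zeroE G : fc_coord fc_zero G = 0.
Proof. exact: linear0. Qed.
Lemma fc_addE a b G : fc_coord (fc_add a b) G = fc_coord a G + fc_coord b G.
Proof. by rewrite /= scale1r. Qed.
Lemma fc_scaleE r a G : fc_coord (fc_scale r a) G = r *: fc_coord a G.
Proof.
rewrite -[LHS]/(r *: fc_coord a G + fc_coord fc_zero G).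
by rewrite fc_zeroE addr0.
Qed.
Lemma fc_oppE a G : fc_coord (fc_opp a) G = - fc_coord a G.
Proof. by rewrite fc_scaleE scaleN1r. Qed.

Let fcE := (fc_zeroE, fc_addE, fc_scaleE, fc_oppE).

Fact fc_addA : associative fc_add.
Proof. by move=> a b c; apply: fc_completion_eq => G; rewrite !fcE addrA. Qed.
Fact fc_addC : commutative fc_add.
Proof. by move=> a b; apply: fc_completion_eq => G; rewrite !fcE addrC. Qed.
Fact fc_add0 : left_id fc_zero fc_add.
Proof. by move=> a; apply: fc_completion_eq => G; rewrite !fcE add0r. Qed.
Fact fc_addN : left_inverse fc_zero fc_opp fc_add.
Proof. by move=> a; apply: fc_completion_eq => G; rewrite !fcE addNr. Qed.

HB.instance Definition _ := GRing.isZmodule.Build fc_completion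
  fc_addA fc_addC fc_add0 fc_addN.

Fact fc_scaleA r s a : fc_scale r (fc_scale s a) = fc_scale (r * s) a.
Proof. by apply: fc_completion_eq => G; rewrite !fcE scalerA. Qed.
Fact fc_scale1 : left_id 1 fc_scale.
Proof. by move=> a; apply: fc_completion_eq => G; rewrite !fcE scale1r. Qed.
Fact fc_scaleDr : right_distributive fc_scale +%R.
Proof.
by move=> r a b; apply: fc_completion_eq => G; rewrite !fcE scalerDr.
Qed.
Fact fc_scaleDl a : {morph fc_scale^~ a : r s / r + s}.
Proof.
by move=> r s; apply: fc_completion_eq => G; rewrite !fcE scalerDl.
Qed.

HB.instance Definition _ := GRing.Zmodule_isLmodule.Build R fc_completion
  fc_scaleA fc_scale1 fc_scaleDr fc_scaleDl.

(** A Cauchy net amounts to a compatible family of cosets, and its limits are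
    the elements of [M] in all of them. *)
Definition fc_complete : Prop :=
  forall a : fc_completion, exists x : M, fc_const x = a.

End Completion.

Section RingCompletion.
Variable R : comPzRingType.

Definition Rtilde : Type := fc_completion R^o.

HB.instance Definition _ := GRing.Lmodule.on Rtilde.

Implicit Types (a b c : Rtilde).

Definition quot_mul (G : ideal R) (x y : quotmod G) : quotmod G :=
  quot_proj G ((repr x : R) * repr y).

Lemma quot_mulE (G : ideal R) (x y : R^o) :
  quot_mul (quot_proj G x) (quot_proj G y) = quot_proj G (x * y).
Proof.
rewrite /quot_mul; set x' := repr _; set y' := repr _.
have Gx : x' - x \in G by apply: quot_reprB.
have Gy : y' - y \in G by apply: quot_reprB.
apply/quot_piP; have -> : (x' : R) * y' - x * y = x' *: (y' - y) + y *: (x' - x).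
  rewrite /GRing.scale /= !mulrBr [(y : R) * x']mulrC [(y : R) * x]mulrC.
  by rewrite addrA subrK.
by rewrite rpredD ?rpredZ.
Qed.

Fact Rtilde_mulP a b (G H : fc_open R^o) (x : R^o) : {subset G <= H} ->
  quot_mul (fc_coord a G) (fc_coord b G) = quot_proj G x ->
  quot_mul (fc_coord a H) (fc_coord b H) = quot_proj H x.
Proof.
move=> GH; have [y ay] := quot_projP (fc_coord a G).
have [z bz] := quot_projP (fc_coord b G).
rewrite ay bz (fc_coordP GH ay) (fc_coordP GH bz) !quot_mulE.
exact: quot_proj_sub.
Qed.

Definition Rtilde_mul a b : Rtilde := FcCompletion (@Rtilde_mulP a b).
Definition Rtilde_one : Rtilde := fc_const (1 : R^o).

Fact Rtilde_mulA : associative Rtilde_mul.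
Proof.
move=> a b c; apply: fc_completion_eq => G /=.
have [x ->] := quot_projP (fc_coord a G).
have [y ->] := quot_projP (fc_coord b G).
have [z ->] := quot_projP (fc_coord c G).
by rewrite (quot_mulE G y) (quot_mulE G x y) !quot_mulE mulrA.
Qed.

Fact Rtilde_mulC : commutative Rtilde_mul.
Proof.
by move=> a b; apply: fc_completion_eq => G /=; rewrite /quot_mul mulrC.
Qed.

Fact Rtilde_mul1 : left_id Rtilde_one Rtilde_mul.
Proof.
move=> a; apply: fc_completion_eq => G /=.
by have [x ->] := quot_projP (fc_coord a G); rewrite quot_mulE mul1r.
Qed.

Fact Rtilde_mulDl : left_distributive Rtilde_mul +%R.
Proof.
move=> a b c; apply: fc_completion_eq => G; rewrite fc_addE.
change (quot_mul (fc_coord (fc_add a b) G) (fc_coord c G) =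
  quot_mul (fc_coord a G) (fc_coord c G) +
  quot_mul (fc_coord b G) (fc_coord c G)); rewrite fc_addE.
have [x ->] := quot_projP (fc_coord a G).
have [y ->] := quot_projP (fc_coord b G).
have [z ->] := quot_projP (fc_coord c G).
by rewrite -linearD !quot_mulE -linearD mulrDl.
Qed.

HB.instance Definition _ := GRing.Zmodule_isComPzRing.Build Rtilde
  Rtilde_mulA Rtilde_mulC Rtilde_mul1 Rtilde_mulDl.

End RingCompletion.

Section RingNotions.
Variable R : comPzRingType.

Definition chain_ring : Prop :=
  forall I J : ideal R, {subset I <= J} \/ {subset J <= I}.

Definition maximal_ideal (I : ideal R) : Prop :=
  1 \notin I /\
  forall J : ideal R, {subset I <= J} -> 1 \notin J -> {subset J <= I}.

Definition local_ring : Prop :=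
  exists P : ideal R, maximal_ideal P /\
    forall Q : ideal R, maximal_ideal Q -> Q =i P.

Definition ideal_square (I : {pred R^o}) : {pred R^o} :=
  generated [set x : R^o | exists y z : R^o, [/\ y \in I, z \in I & x = y * z]].

Definition gaussian_local_ring : Prop :=
  local_ring /\
  forall a b : R^o,
    let A2 := ideal_square (generated [set a; b]) in
    (A2 =i generated [set a ^+ 2] \/ A2 =i generated [set b ^+ 2]) /\
    (A2 =i generated [set a ^+ 2] -> a * b = 0 -> b ^+ 2 = 0).

End RingNotions.

Section CompletionInHull.
Variables (R : comPzRingType) (P : ideal R).
Variables (Rhat : lmodType R) (iota : {linear R^o -> Rhat}).

Definition scaled_ideal (r : R) : set R :=
  [set x | exists2 p : R, p \in P & x = r * p].

Definition scaled_ideal_mul (r : R) : {pred Rhat} :=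
  generated [set y : Rhat | exists2 x, scaled_ideal r x & exists z, y = x *: z].

HB.instance Definition _ r := GRing.SubmodClosed.on (scaled_ideal_mul r).

(** [y] lies in [a_r + r P Rhat] for every nonzero [r]. Over a chain ring with
    maximal ideal [P], [R / r P] is finitely cogenerated, so [r P] is (up to
    extensional equality) an index [G] of the completion; [s] is any
    representative [a_r] of the coordinate of [a] at [r P]. *)
Definition in_all_cosets (a : Rtilde R) (y : Rhat) : Prop :=
  forall (r : R) (G : fc_open R^o) (s : R^o), r != 0 ->
    (forall x, x \in G <-> scaled_ideal r x) ->
    fc_coord a G = quot_proj G s -> y - iota s \in scaled_ideal_mul r.

(** The image of the completion of [R] in the pure-injective hull
    [iota : R -> Rhat]. *)
Definition Rtilde_in_hull : {pred Rhat} := fun y =>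
  `[< (finitely_cogenerated R^o /\ y \in linear_range iota) \/
      (~ finitely_cogenerated R^o /\
       exists a : Rtilde R, in_all_cosets a y) >].

Lemma scaled_ideal_iota (r : R) (x : R^o) :
  scaled_ideal r x -> iota x \in scaled_ideal_mul r.
Proof.
move=> rx; apply/asboolP=> N; apply; exists x => //; exists (iota 1).
by rewrite -linearZ /= [_ *: _]mulr1.
Qed.

Lemma Rtilde_in_hull_closed : submod_closed Rtilde_in_hull.
Proof.
split.
  apply/asboolP; have [fc|nfc] := pselect (finitely_cogenerated R^o).
    by left; rewrite rpred0.
  right; split=> //; exists 0 => r G s r0 Gr.
  rewrite fc_zeroE -(linear0 (quot_proj G)) => /quot_piP /Gr rs.
  by rewrite -(linear0 iota) -linearB scaled_ideal_iota.
move=> k y z /asboolP[[fc yr]|[nfc [a ay]]] /asboolP[[fc' zr]|[nfc' [b bz]]] //;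
  apply/asboolP.
  by left; rewrite rpredD ?rpredZ.
right; split=> //; exists (k *: a + b) => r G s r0 Gr.
rewrite fc_addE fc_scaleE.
have [u au] := quot_projP (fc_coord a G).
have [v bv] := quot_projP (fc_coord b G).
rewrite au bv -linearP => /quot_piP /Gr rs.
have uy := ay r G u r0 Gr au; have vz := bz r G v r0 Gr bv.
have -> : k *: y + z - iota s =
    k *: (y - iota u) + (z - iota v) + iota (k *: u + v - s).
  rewrite (linearB iota) (linearP iota) scalerBr (addrACA (k *: y)) -opprD.
  by rewrite [RHS]addrA subrK.
by rewrite rpredD ?scaled_ideal_iota // rpredD ?rpredZ.
Qed.

HB.instance Definition _ :=
  GRing.isSubmodClosed.Build R Rhat Rtilde_in_hull Rtilde_in_hull_closed.

End CompletionInHull.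

(* Main.v *)
Require Import Defs.
From HB Require Import structures.
From mathcomp Require Import all_boot all_order all_algebra perm.
From mathcomp Require Import boolp classical_sets functions.

Set Implicit Arguments.
Unset Strict Implicit.
Unset Printing Implicit Defensive.

Import Order.TTheory GRing.Theory Num.Theory.

Local Open Scope ring_scope.
Local Open Scope quotient_scope.

(** The f.c. open ideals of [R] other than [R] are the [r P], [r <> 0], so an
    element of the completion is a compatible family of cosets [a_r + r P].
    When [R] is neither a domain nor complete, pick [r <> 0] with [r ^ 2 = 0]. A
    zero divisor [c] sees only one coordinate, whence [c R~ = c R]. An element
    whose coordinate at [r P] is regular is the product of that coordinate and a
    unit, whereas the product of two elements with zero-divisor coordinates lies
    in [R]; comparing the coordinates [s u], [s' u'] of such elements ([u], [u']
    units) gives the Gaussian property. If [a] is not in [R], then [a - a_r] and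
    [r] are incomparable in [R~], and [r (a - a_r) = 0] although [a - a_r] is not
    in [(0 : r) R~], so that [R~] is neither a chain ring nor flat; purity in the
    hull would give [a - a_r = r z], hence [a] in [R].
    If [R] is a domain, every nonzero element of [R~] is a unit times an element
    of [R], and flatness amounts to torsion-freeness.

    Over a chain ring matrices are diagonalizable, so purity is relative
    divisibility, and pure-essentiality forces the intersection of the [r R^] to
    vanish (when the socle of [R] does) and [R^] to be torsion-free over a domain.
    That the [r P] are open rests on the existence of injective hulls. *)

(** * Injective hulls *)

Section Generalities.
Variable R : comPzRingType.
Implicit Types M E B : lmodType R.

(** Finite cogeneration is phrased through injective hulls, purity and flatness through all tensor
    products, and the completion through all open submodules; each has to be brought down to
    elements. A tensor product is an inductively generated congruence on formal sums, so a vanishing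
    sum comes with a derivation, and this involves finitely many linear relations. Purity and
    flatness thus become the solving of finite linear systems, which a chain ring diagonalizes. An
    [r] with square zero is decisive because two elements of the completion whose coordinate at
    [r P] is 0 have all finer coordinates in [r P], so that their product vanishes. As the
    completion need not be a chain ring, the Gaussian argument cannot compare its elements by
    divisibility; what survives is that the fine enough coordinates of a nonzero element are all
    associated to one [s] in [R]. The hull is given and known only by its defining properties:
    pure-injectivity produces limits in it, and pure-essentiality makes them unique. *)

Lemma linear_exists M E (g : M -> E) :
  linear g -> exists g' : {linear M -> E}, g' =1 g.
Proof.
move=> lg; pose L := GRing.isLinear.Build R M E _ g lg.
by pose g' : {linear M -> E} := HB.pack g L; exists g'.
Qed.

(** Submodules as bare sets, the form suited to Zorn's lemma and to graphs; [set_submod] turns them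
    back into predicates. *)
Definition submod_set M (X : set M) : Prop :=
  X 0 /\ forall a x y, X x -> X y -> X (a *: x + y).

Definition set_submod M (X : set M) (hX : submod_set X) : {pred M} :=
  fun x => `[< X x >].

Lemma set_submod_closed M (X : set M) (hX : submod_set X) :
  submod_closed (set_submod hX).
Proof.
case: (hX) => X0 XP; split=> [|a x y /asboolP Xx /asboolP Xy]; apply/asboolP => //.
exact: XP.
Qed.

HB.instance Definition _ M (X : set M) (hX : submod_set X) :=
  GRing.isSubmodClosed.Build R M (set_submod hX) (set_submod_closed hX).

Lemma set_submodP M (X : set M) (hX : submod_set X) x :
  reflect (X x) (x \in set_submod hX).
Proof. exact: asboolP. Qed.

Lemma submod_setZ M (X : set M) a x : submod_set X -> X x -> X (a *: x).
Proof. by case=> X0 XP Xx; rewrite -[_ *: _]addr0; apply: XP. Qed.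

Lemma submod_setD M (X : set M) x y : submod_set X -> X x -> X y -> X (x + y).
Proof. by case=> X0 XP Xx; rewrite -[x]scale1r; apply: XP. Qed.

Lemma submod_setN M (X : set M) x : submod_set X -> X x -> X (- x).
Proof. by rewrite -scaleN1r; apply: submod_setZ. Qed.

Lemma submod_setB M (X : set M) x y : submod_set X -> X x -> X y -> X (x - y).
Proof. by move=> hX Xx Xy; apply: submod_setD => //; apply: submod_setN. Qed.

Lemma submod_closed_set M (K : submodClosed M) : submod_set (fun x => x \in K).
Proof. by split=> [|a x y Kx Ky]; rewrite ?rpred0 // rpredD ?rpredZ. Qed.

(** [Zorn_bigcup] covers the empty chain too, whose union is empty, so the empty set is adjoined to
    [P]; [P X0] keeps the maximal element in [P]. *)
Lemma Zorn_nonempty T (P : set (set T)) (X0 : set T) : P X0 ->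
  (forall F : set (set T), (F `<=` P)%classic -> total_on F subset ->
     (exists X, F X) -> P (\bigcup_(X in F) X)%classic) ->
  exists A, P A /\ forall C, (A `<=` C)%classic -> P C -> (C `<=` A)%classic.
Proof.
move=> PX0 Pcup; pose P' X := X = set0 \/ P X.
have [F FP' tF|A [P'A maxA]] := @Zorn_bigcup T P'.
  have [[X [FX PX]]|noP] := pselect (exists X, F X /\ P X); last first.
    left; apply/seteqP; split=> // x [X FX Xx]; have [X0'|PX] := FP' _ FX.
      by rewrite X0' in Xx.
    by case: noP; exists X.
  right; have := Pcup (fun Y => F Y /\ P Y).
  have -> : (\bigcup_(Y in (fun Y => F Y /\ P Y)) Y = \bigcup_(Y in F) Y)%classic.
    apply/seteqP; split=> x [Y]; first by move=> [FY _] Yx; exists Y.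
    move=> FY Yx; have [Y0|PY] := FP' _ FY; last by exists Y.
    by rewrite Y0 in Yx.
  apply; first by move=> Y [].
    by move=> Y Z [FY _] [FZ _]; apply: tF.
  by exists X.
exists A; split.
  case: P'A => // A0; have [X00|] := pselect (X0 = set0); first by rewrite A0 -X00.
  move=> nX0; case: (maxA X0); [|by right].
  rewrite A0; split; first exact: sub0set.
  by move=> X0s; apply: nX0; apply/seteqP; split=> //; apply: sub0set.
move=> C AC PC; apply: contrapT => nCA; case: (maxA C); [|by right].
by split.
Qed.

Lemma submod_set_bigcup M (F : set (set M)) :
  (forall X, F X -> submod_set X) -> total_on F subset ->
  (exists X, F X) -> submod_set (\bigcup_(X in F) X)%classic.
Proof.
move=> FS tF [X FX]; split; first by exists X => //; case: (FS X FX).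
move=> a x y [Y FY Yx] [Z FZ Zy].
have [YZ|ZY] := tF _ _ FY FZ.
  by exists Z => //; apply: (FS Z FZ).2 => //; apply: YZ.
by exists Y => //; apply: (FS Y FY).2 => //; apply: ZY.
Qed.

(** A partial homomorphism defined on a submodule of [B]; by linearity, single-valuedness is a
    condition at 0. *)
Definition functional_graph B E (G : set (B * E)%type) : Prop :=
  submod_set (G : set (B * E : lmodType R)) /\ forall z, G (0, z) -> z = 0.

Lemma graph_uniq B E (G : set (B * E)%type) b z z' :
  functional_graph G -> G (b, z) -> G (b, z') -> z = z'.
Proof.
move=> [sG fG] Gz Gz'; apply/eqP; rewrite -subr_eq0; apply/eqP/fG.
by rewrite -(subrr b); exact: (submod_setB sG Gz Gz').
Qed.

(* A homomorphism from an ideal of [R] to [E] is given by its graph. *)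
Definition baer E : Prop := forall H : set (R^o * E)%type,
  functional_graph H -> exists e, forall r z, H (r, z) -> z = r *: e.

(** Baer's criterion, by Zorn's lemma on the partial homomorphisms extending [G0]: a maximal one is
    total. *)
Lemma baer_extension B E (G0 : set (B * E)%type) :
  baer E -> functional_graph G0 ->
  exists g : {linear B -> E}, forall b z, G0 (b, z) -> g b = z.
Proof.
move=> bE fG0.
pose P (G : set (B * E)%type) := functional_graph G /\ (G0 `<=` G)%classic.
have [|F FP tF [X FX]|A [[fA G0A] maxA]] := @Zorn_nonempty _ P G0.
- by split.
- split; last by move=> u G0u; exists X => //; apply: (FP X FX).2.
  split; last by move=> z [Y FY]; apply: (FP Y FY).1.2.
  apply: submod_set_bigcup => //; last by exists X.
  by move=> Y FY; apply: (FP Y FY).1.1.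
have [sA _] := fA; have [A0 AP] := sA.
have tot b : exists z, A (b, z).
  (* The [r] with [r *: b] in the domain form an ideal; [e] is a value at [b] that agrees with [A]
     on that ideal. *)
  pose H (u : R^o * E) := A (u.1 *: b, u.2).
  have [e eP] : exists e, forall r z, H (r, z) -> z = r *: e.
    apply: bE; split; last by move=> z; rewrite /H /= scale0r; apply: fA.2.
    split; first by rewrite /H /= scale0r.
    move=> a [r z] [r' z'] /= Hx Hy; rewrite /H /= scalerDl -scalerA.
    exact: (AP a _ _ Hx Hy).
  pose A' (u : B * E) := exists r x z, A (x, z) /\ u = (x + r *: b, z + r *: e).
  suff: A' (b, e).
    move=> A'b; exists e; apply: (maxA A') => //.
      move=> [x z] Axz; exists 0, x, z; split=> //.
      by rewrite !scale0r !addr0.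
    split; last first.
      move=> [x z] /G0A Axz; exists 0, x, z; split=> //.
      by rewrite !scale0r !addr0.
    split; [split|].
    - by exists 0, 0, 0; split=> //; rewrite !scale0r !addr0.
    - move=> a _ _ [r [x [z [Ax ->]]]] [r' [x' [z' [Ax' ->]]]].
      exists (a * r + r'), (a *: x + x'), (a *: z + z'); split.
        exact: (AP a _ _ Ax Ax').
      by congr pair; rewrite /= scalerDr scalerDl -scalerA addrACA.
    - move=> z [r [x [y [Ax [xr ->]]]]].
      have /eP : H (r, - y).
        have := submod_setN sA Ax; rewrite /H /= .
        by rewrite (_ : r *: b = - x) //; apply/eqP; rewrite -addr_eq0 addrC -xr.
      by move=> <-; rewrite subrr.
  by exists 1, 0, 0; split=> //; rewrite !scale1r !add0r.
have [g gP] := choice tot.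
have lg : linear g.
  move=> a x y; apply: (graph_uniq fA (gP _)).
  exact: (AP a _ _ (gP x) (gP y)).
have [g' g'E] := linear_exists lg; exists g' => b z /G0A Abz.
by rewrite g'E; apply: (graph_uniq fA (gP _)).
Qed.

Lemma baer_injective E : baer E -> injective_module E.
Proof.
move=> bE A B i f inji.
have [|g gP] := @baer_extension B E (fun u => exists x, u = (i x, f x)) bE.
  split; [split|].
  - by exists 0; rewrite !linear0.
  - by move=> a _ _ [x ->] [y ->]; exists (a *: x + y); rewrite !linearP.
  - by move=> z [x [ix ->]]; rewrite (_ : x = 0) ?linear0 //; apply: inji; rewrite linear0.
by exists g => x; apply: gP; exists x.
Qed.

Lemma baer_fct (I : Type) E : baer E -> baer (I -> E).
Proof.
move=> bE H [[H0 HP] fH].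
have /choice[e eP] : forall i, exists e, forall r z, H (r, z) -> z i = r *: e.
  move=> i; have [|e eP] := bE (fun u => exists2 z, H (u.1, z) & u.2 = z i).
    split; [split|].
    - by exists 0.
    - move=> a [r z] [s y] /= [u Hu ->] [v Hv ->].
      by exists (a *: u + v) => //; apply: (HP a _ _ Hu Hv).
    - by move=> _ [z /= Hz ->]; rewrite (fH z Hz).
  by exists e => r z Hz; apply: eP; exists z.
by exists e => r z Hz; apply/funext => i; apply: eP.
Qed.

End Generalities.

(** * The group Q/Z and the characters of abelian groups *)

Definition int_rat : set (zmodule rat) := fun q => exists n : int, q = n%:~R.

Lemma int_rat_submod : submod_set (int_rat : set (zmodule rat : lmodType int)).
Proof.
split; first by exists 0.
by move=> a _ _ [m ->] [n ->]; exists (a * m + n); rewrite scalezrE -mulrzA mulrC rmorphD.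
Qed.

Definition QmodZ : lmodType int := quotmod (set_submod int_rat_submod).

Definition toQmodZ (q : rat) : QmodZ := quot_proj (set_submod int_rat_submod) q.

Lemma toQmodZ_surj z : exists q, z = toQmodZ q.
Proof. by have [y ->] := quot_projP z; exists y. Qed.

Lemma toQmodZ_scale (n : int) q : toQmodZ (n%:~R * q) = n *: toQmodZ q.
Proof.
rewrite mulrzl; exact: (linearZZ (quot_proj (set_submod int_rat_submod)) n (q : zmodule rat)).
Qed.

Lemma toQmodZ_eq0 q : toQmodZ q = 0 <-> exists n : int, q = n%:~R.
Proof.
rewrite /toQmodZ -(linear0 (quot_proj (set_submod int_rat_submod))); split.
  by move=> /quot_piP /set_submodP; rewrite subr0.
by move=> qZ; apply/quot_piP/set_submodP; rewrite subr0.
Qed.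

Lemma int_ideal_gen (I : set int^o) : submod_set I ->
  (forall r, I r -> r = 0) \/
  exists n : nat, [/\ (0 < n)%N, I n%:Z & forall r, I r -> (n %| r)%Z].
Proof.
move=> sI; have [I0|nI0] := pselect (forall r, I r -> r = 0); [by left|right].
have exI : exists n : nat, (0 < n)%N && `[< I n%:Z >].
  apply: contrapT => nex; apply: nI0 => r Ir; apply/eqP; apply: contrapT => /negP r0.
  apply: nex; exists `|r|%N; rewrite absz_gt0 r0; apply/asboolP.
  have [r0'|r0'] := lerP 0 r; first by rewrite gez0_abs.
  by rewrite ltz0_abs //; exact: (@submod_setN _ int^o).
case: (ex_minnP exI) => n /andP[n0 /asboolP In] nmin; exists n; split=> // r Ir.
have Im : I (r %% n)%Z.
  rewrite /modz addrC -mulNr.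
  exact: (sI.2 (- (r %/ n)%Z) _ _ In Ir).
have n0' : n%:Z != 0 by case: (n) n0.
apply/dvdz_mod0P; have := ltz_pmod r (n0 : 0 < n%:Z); have := modz_ge0 r n0'.
case: (r %% n)%Z Im => // m Im _; rewrite ltz_nat => mn.
case: (posnP m) => [->//|m0]; have := nmin m; rewrite m0 => /(_ (asboolT Im)).
by rewrite leqNgt mn.
Qed.

(** Q/Z is divisible: if [n] generates the ideal and goes to the class of [q], take the class of
    [q / n]. *)
Lemma QmodZ_baer : baer QmodZ.
Proof.
move=> H fH; have [sH fH0] := fH.
have sI : submod_set ((fun r => exists z, H (r, z)) : set int^o).
  split; first by exists 0; case: sH.
  move=> a r s [z Hz] [w Hw]; exists (a *: z + w); exact: (sH.2 a _ _ Hz Hw).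
have [I0|[n [n0 [z Hz] nP]]] := int_ideal_gen sI.
  exists 0 => r z Hz; have r0 : r = 0 by apply: I0; exists z.
  by rewrite scaler0; apply: fH0; rewrite -r0.
have [q zq] := toQmodZ_surj z.
exists (toQmodZ (q / n%:R)) => r w Hw.
have /dvdzP[m rm] : (n %| r)%Z by apply: nP; exists w.
have -> : w = m *: z.
  apply: (graph_uniq fH Hw); rewrite rm; exact: (submod_setZ m sH Hz).
rewrite zq rm -!toQmodZ_scale; congr toQmodZ.
rewrite intrM -mulrA; congr (_ * _); rewrite mulrCA divff ?mulr1 //.
by rewrite pnatr_eq0 -lt0n.
Qed.

(** The subgroup generated by [x] maps to Q/Z without killing [x], and injectivity of Q/Z extends
    this map. *)
Lemma character_separates (M : zmodType) (x : M) : x != 0 ->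
  exists f : {linear zmodule M -> QmodZ}, f x != 0.
Proof.
move=> x0.
pose I : set int^o := fun m => m *: (x : zmodule M) = 0.
have sI : submod_set I.
  split; first by rewrite /I scale0r.
  move=> a m n /= Im In; rewrite /I scalerDl -scalerA.
  by rewrite Im In scaler0 addr0.
(* The value at [x] is the class of [1 / n] when [x] has order [n], and that of [1 / 2] when its
   order is infinite. *)
have [c [c0 cI]] : exists c : QmodZ, c != 0 /\ forall m, I m -> m *: c = 0.
  have frac (n : nat) : (1 < n)%N ->
      toQmodZ n%:R^-1 != 0 /\ forall m, (n %| m)%Z -> m *: toQmodZ n%:R^-1 = 0.
    move=> n1; have n0 : n%:R != 0 :> rat by rewrite pnatr_eq0 -lt0n ltnW.
    split.
      apply/eqP => /toQmodZ_eq0[m nm].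
      have : (n %| 1)%Z.
        by apply/dvdzP; exists m; apply: (@intr_inj rat); rewrite intrM -nm mulVf.
      by rewrite dvdzE /= dvdn1 => /eqP n1'; rewrite n1' in n1.
    move=> _ /dvdzP[m ->]; rewrite -toQmodZ_scale intrM -mulrA mulfV // mulr1.
    by apply/toQmodZ_eq0; exists m.
  have [I0|[n [n0 In nP]]] := int_ideal_gen sI.
    exists (toQmodZ 2%:R^-1); have [h _] := frac 2%N isT; split=> // m /I0 ->.
    by rewrite scale0r.
  exists (toQmodZ n%:R^-1).
  have n1 : (1 < n)%N.
    rewrite ltn_neqAle n0 andbT; apply/eqP => n1; move: In x0; rewrite -n1 /I scale1r.
    by move=> ->; rewrite eqxx.
  have [h1 h2] := frac n n1; split=> // m Im; apply: h2; exact: nP.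
pose G0 (u : zmodule M * QmodZ) := exists m : int, u = (m *: (x : zmodule M), m *: c).
have [|f fP] := baer_extension (G0 := G0) QmodZ_baer.
  split; [split|].
  - by exists 0; rewrite !scale0r.
  - move=> a _ _ [m ->] [n ->]; exists (a * m + n).
    by congr pair; rewrite /= !scalerDl !scalerA.
  - by move=> z [m [mx ->]]; apply: cI.
by exists f; rewrite (fP x c) //; exists 1; rewrite !scale1r.
Qed.

(** * An injective module over an arbitrary commutative ring *)

Section CharacterModule.
Variable R : comPzRingType.

(* [Hom_Z(R, Q/Z)], with [(r *: f) s = f (r * s)]. *)
Record charmod : Type := CharMod {
  char_fun :> zmodule R -> QmodZ;
  char_funP : linear char_fun
}.

HB.instance Definition _ := gen_eqMixin charmod.
HB.instance Definition _ := gen_choiceMixin charmod.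

Implicit Types f g h : charmod.

Lemma charmod_eq f g : (forall x, f x = g x) -> f = g.
Proof.
case: f g => [f fP] [g gP] /= fg; have {}fg : f = g by apply/funext.
by case: _ / fg gP => gP; congr CharMod; apply: Prop_irrelevance.
Qed.

Lemma char_funZ f a x : f (a *: x) = a *: f x.
Proof. by have [f' fE] := linear_exists (char_funP f); rewrite -!fE linearZZ. Qed.

Fact char_zeroP : linear ((fun _ => 0) : zmodule R -> QmodZ).
Proof. by move=> a x y; rewrite scaler0 addr0. Qed.
Fact char_addP f g : linear (fun x => f x + g x).
Proof. by move=> a x y; rewrite !char_funP scalerDr addrACA. Qed.
Fact char_oppP f : linear (fun x => - f x).
Proof. by move=> a x y; rewrite !char_funP opprD scalerN. Qed.
Fact char_scaleP (r : R) f : linear (fun x : zmodule R => f ((r : R) * x : R)).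
Proof.
by move=> a x y; rewrite -char_funP; congr (f _); rewrite !scalezrE mulrDr mulrzAr.
Qed.

Definition char_zero := CharMod char_zeroP.
Definition char_add f g := CharMod (char_addP f g).
Definition char_opp f := CharMod (char_oppP f).
Definition char_scale r f := CharMod (char_scaleP r f).

Fact char_addA : associative char_add.
Proof. by move=> f g h; apply: charmod_eq => x /=; rewrite addrA. Qed.
Fact char_addC : commutative char_add.
Proof. by move=> f g; apply: charmod_eq => x /=; rewrite addrC. Qed.
Fact char_add0 : left_id char_zero char_add.
Proof. by move=> f; apply: charmod_eq => x /=; rewrite add0r. Qed.
Fact char_addN : left_inverse char_zero char_opp char_add.
Proof. by move=> f; apply: charmod_eq => x /=; rewrite addNr. Qed.

HB.instance Definition _ := GRing.isZmodule.Build charmod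
  char_addA char_addC char_add0 char_addN.

Fact char_scaleA a b f : char_scale a (char_scale b f) = char_scale (a * b) f.
Proof. by apply: charmod_eq => x /=; rewrite mulrA [b * a]mulrC. Qed.
Fact char_scale1 : left_id 1 char_scale.
Proof. by move=> f; apply: charmod_eq => x /=; rewrite mul1r. Qed.
Fact char_scaleDr : right_distributive char_scale +%R.
Proof. by move=> r f g; apply: charmod_eq. Qed.
Fact char_scaleDl f : {morph char_scale^~ f : r s / r + s}.
Proof.
move=> r s; apply: charmod_eq => x /=; rewrite mulrDl.
by have := char_funP f 1 ((r : R) * x : R) ((s : R) * x : R); rewrite !scale1r.
Qed.

HB.instance Definition _ := GRing.Zmodule_isLmodule.Build R charmod
  char_scaleA char_scale1 char_scaleDr char_scaleDl.

(** Evaluation at 1 turns an [R]-linear map into [charmod] into an additive map to Q/Z. The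
    extension [e] of the latter to [R] is itself a character, hence the required element. *)
Lemma charmod_baer : baer charmod.
Proof.
move=> H fH; have [[H0 HP] fH0] := fH.
pose G0 (u : zmodule R * QmodZ) := exists2 f : charmod, H (u.1 : R^o, f) & u.2 = f 1.
have [|e eP] := baer_extension (G0 := G0) QmodZ_baer.
  split; [split|].
  - by exists 0.
  - move=> a [r _] [s _] [f /= Hf ->] [g /= Hg ->].
    exists (a%:~R *: f + g); rewrite /=.
      rewrite scalezrE -mulrzl; exact: (HP a%:~R _ _ Hf Hg).
    rewrite -char_funZ -[RHS]/(f ((a%:~R : R) * 1 : R) + g 1); congr (f _ + _).
    by rewrite scalezrE mulrzl.
  - by move=> _ [f /= Hf ->]; rewrite (fH0 f Hf).
exists (CharMod (linearP e)) => r f Hf; apply: charmod_eq => s /=.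
have Hs : H (s * r : R^o, s *: f) := submod_setZ s fH.1 Hf.
rewrite mulrC (eP _ (f s)) //; exists (s *: f) => //=.
by rewrite mulr1.
Qed.

End CharacterModule.

(** * Embedding in an injective module and existence of hulls *)

Section InjectiveHull.
Variable R : comPzRingType.
Implicit Types M E B : lmodType R.

(** Each [m] goes to the family of the [r |-> c (r *: m)], for all characters [c] of [M]; these
    separate points already at [r = 1]. *)
Lemma baer_embedding M : exists (E : lmodType R) (j : {linear M -> E}),
  baer E /\ injective j.
Proof.
pose I := {linear zmodule M -> QmodZ}.
exists (I -> charmod R)%type.
have ch (c : I) (m : M) : linear (fun r : zmodule R => c ((r : R) *: m)).
  move=> a x y; rewrite -linearP; congr (c _).
  by rewrite !scalezrE scalerDl scalerMzl.
pose j (m : M) (c : I) := CharMod (ch c m).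
have lj : linear j.
  move=> a x y; apply/funext => c; apply: charmod_eq => r /=.
  by rewrite scalerDr linearD scalerA mulrC.
have [j' jE] := linear_exists lj; exists j'; split.
  by apply: baer_fct; apply: charmod_baer.
have kj x : j x = 0 -> x = 0.
  move=> jx; apply/eqP; apply: contrapT => /negP x0.
  have [c /eqP] := character_separates x0; apply.
  by have := congr1 (fun f : charmod R => f 1) (congr1 (fun f => f c) jx); rewrite /= scale1r.
move=> x y; rewrite !jE => jxy; apply/eqP; rewrite -subr_eq0; apply/eqP/kj.
by rewrite -jE linearB !jE jxy subrr.
Qed.

Definition essential_over M E (k : M -> E) (X : set E) : Prop :=
  forall x, X x -> x != 0 -> exists r m, r *: x = k m /\ r *: x != 0.

(** Inside an injective [E], a maximal essential extension [A] of the image of [M] is a direct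
    summand, and Baer's condition passes to summands. *)
Lemma injective_hull_exists M :
  exists (E : lmodType R) (j : {linear M -> E}), baer E /\ injective_hull j.
Proof.
have [E [k [bE injk]]] := baer_embedding M.
pose K : set E := fun y => exists m, y = k m.
have sK : submod_set K.
  split; first by exists 0; rewrite linear0.
  by move=> a _ _ [x ->] [y ->]; exists (a *: x + y); rewrite linearP.
pose P (X : set E) := [/\ submod_set X, (K `<=` X)%classic & essential_over k X].
have [|F FP tF [X FX]|A [[sA KA eA] maxA]] := @Zorn_nonempty _ P K.
- split=> // _ [m ->] km0; exists 1, m.
  by rewrite scale1r.
- split.
  + by apply: submod_set_bigcup => //; [move=> Y /FP[]|exists X].
  + by move=> x Kx; exists X => //; have [_ KX _] := FP X FX; apply: KX.
  + by move=> x [Y FY Yx]; have [_ _ eY] := FP Y FY; apply: eY.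
(* A maximal submodule [C] meeting [A] only in 0 will be the complement of [A]. *)
pose Q (X : set E) := submod_set X /\ forall x, X x -> A x -> x = 0.
have [|F FQ tF [X FX]|C [[sC CA] maxC]] := @Zorn_nonempty _ Q [set 0].
- by split=> [|x /= ->//]; split=> // a x y /= -> ->; rewrite scaler0 addr0.
- split; last by move=> x [Y FY Yx]; apply: (FQ Y FY).2.
  by apply: submod_set_bigcup => //; [move=> Y /FQ[]|exists X].
have [g gP] : exists g : {linear E -> E}, forall a c, A a -> C c -> g (a + c) = a.
  have [|g gP] := @baer_extension R E E
      (fun u => exists a c, [/\ A a, C c & u = (a + c, a)]) bE.
    split; [split|].
    - exists 0, 0; split; [by case: sA|by case: sC|by rewrite addr0].
    - move=> r _ _ [a [c [Aa Cc ->]]] [b [d [Ab Cd ->]]].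
      exists (r *: a + b), (r *: c + d); split; [exact: sA.2|exact: sC.2|].
      by congr pair; rewrite /= scalerDr addrACA.
    - move=> z [a [c [Aa Cc [ac ->]]]]; apply: CA => //.
      rewrite (_ : a = - c); first exact: submod_setN.
      by apply/eqP; rewrite -addr_eq0 -ac.
  by exists g => a c Aa Cc; apply: gP; exists a, c.
have A0 : A 0 by case: sA.
have C0 : C 0 by case: sC.
have gA a : A a -> g a = a by move=> Aa; rewrite -{1}[a]addr0 gP.
have gC c : C c -> g c = 0 by move=> Cc; rewrite -{1}[c]add0r gP.
(* By maximality of [C]: if [g x = 0], then [g] kills [C + R x] but is the identity on [A], so the
   two meet only in 0. *)
have kerg x : g x = 0 -> C x.
  move=> gx; pose C' (y : E) := exists r c, C c /\ y = c + r *: x.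
  have QC' : Q C'.
    split.
      split; first by exists 0, 0; rewrite scale0r addr0.
      move=> a _ _ [r [c [Cc ->]]] [s [d [Cd ->]]].
      exists (a * r + s), (a *: c + d); split; first exact: sC.2.
      by rewrite scalerDr scalerDl scalerA addrACA.
    by move=> _ [r [c [Cc ->]]] Ay;
      rewrite -(gA _ Ay) linearD linearZZ gx scaler0 gC ?addr0.
  apply: (maxC C' _ QC').
    by move=> c Cc; exists 0, c; rewrite scale0r addr0.
  by exists 1, 0; rewrite scale1r add0r.
(* By maximality of [A], as the image of [g] is essential too: if [g w] is nonzero, then [w] is not
   in [C], so [C + R w] contains a nonzero [a] of [A], and applying [g] gives [a = r *: g w]. *)
have gAA x : A (g x).
  pose A' (y : E) := exists x, y = g x.
  apply: (maxA A'); last by exists x.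
    by move=> a Aa; exists a; rewrite gA.
  split.
  - split; first by exists 0; rewrite linear0.
    by move=> r _ _ [y ->] [z ->]; exists (r *: y + z); rewrite linearP.
  - by move=> y /KA Ay; exists y; rewrite gA.
  move=> _ [w ->] gw0.
  have [r [a [c [Aa Cc a0 acw]]]] : exists r a c, [/\ A a, C c, a != 0 & a = c + r *: w].
    apply: contrapT => nex; move/eqP: gw0; apply; apply: gC.
    pose C' (y : E) := exists r c, C c /\ y = c + r *: w.
    apply: (maxC C'); first by move=> c Cc; exists 0, c; rewrite scale0r addr0.
      split.
        split; first by exists 0, 0; rewrite scale0r addr0.
        move=> a _ _ [r [c [Cc ->]]] [s [d [Cd ->]]].
        exists (a * r + s), (a *: c + d); split; first exact: sC.2.
        by rewrite scalerDr scalerDl scalerA addrACA.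
      move=> y [r [c [Cc yE]]] Ay; apply: contrapT => /eqP y0; apply: nex.
      by exists r, y, c.
    by exists 1, 0; rewrite scale1r add0r.
  have aE : a = r *: g w.
    by rewrite -(gA _ Aa) acw linearD linearZZ gC ?add0r.
  have [s [m [sm s0]]] := eA a Aa a0.
  by exists (s * r), m; rewrite -scalerA -aE.
have split_E x : C (x - g x) by apply: kerg; rewrite linearB (gA _ (gAA x)) subrr.
pose E' : lmodType R := submod (set_submod sA).
have AE' (x : E') : A (val x) by apply/asboolP; exact: valP x.
(* A solution [e] in [E] is projected to [A]: the difference [val z - r *: g e] lies in both [A] and
   [C]. *)
have bE' : baer E'.
  move=> H fH; have [sH fH0] := fH.
  pose H' (u : R^o * E) := exists2 z : E', H (u.1, z) & u.2 = val z.
  have [|e eP] := bE H'.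
    split; [split|].
    - by exists 0; case: sH.
    - move=> a [r _] [s _] [y /= Hy ->] [z /= Hz ->].
      by exists (a *: y + z); [exact: (sH.2 a _ _ Hy Hz)|].
    - by move=> _ [z /= /fH0 -> ->].
  have Age : g e \in set_submod sA by apply/asboolP; apply: gAA.
  exists (Submod Age) => r z Hz; apply: val_inj => /=.
  have ze : val z = r *: e by apply: eP; exists z.
  apply/eqP; rewrite -subr_eq0; apply/eqP; apply: CA.
    by rewrite /= -[submod_val z]/(val z) ze -scalerBr; apply: submod_setZ.
  by apply: submod_setB => //; [apply: AE'|apply: submod_setZ].
have km m : k m \in set_submod sA by apply/asboolP; apply: KA; exists m.
have [j jE] : exists j : {linear M -> E'}, forall m, j m = Submod (km m).
  by apply: linear_exists => a x y; apply: val_inj; rewrite /= linearP.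
exists E', j; split=> //; split; last 1 first.
- move=> L [x Lx x0]; have [|r [m [rm r0]]] := eA (val x) (AE' x).
    by apply: contraNneq x0 => x0; apply/eqP/val_inj.
  exists (r *: x); first by rewrite rpredZ.
  split; first by apply: contraNneq r0 => rx; rewrite -[0]/(val (0 : E')) -rx.
  by apply/asboolP; exists m; rewrite jE; apply: val_inj; rewrite /= -rm.
- by move=> x y; rewrite !jE => /(congr1 val) /= /injk.
- exact: baer_injective.
Qed.

End InjectiveHull.

(** * Finitely cogenerated modules *)

Section FinitelyCogenerated.
Variable R : comPzRingType.
Implicit Types M E : lmodType R.

(** The submodule [R x] is then simple and contained in every nonzero submodule. *)
Definition cocyclic M (x : M) : Prop :=
  x != 0 /\ forall y, y != 0 -> exists a, a *: y = x.

(** The hull of [M] is also a hull of the simple submodule [R x], so one summand suffices. *)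
Lemma cocyclic_finitely_cogenerated M (x : M) :
  cocyclic x -> finitely_cogenerated M.
Proof.
move=> [x0 xP]; have [E [j [_ [injj injE essj]]]] := injective_hull_exists M.
exists E, j; split=> //.
have sS : submod_set (fun y : M => exists a, y = a *: x).
  split; first by exists 0; rewrite scale0r.
  by move=> a _ _ [b ->] [c ->]; exists (a * b + c); rewrite scalerDl scalerA.
pose S : lmodType R := submod (set_submod sS).
have Sx : x \in set_submod sS by apply/asboolP; exists 1; rewrite scale1r.
have valS (y : S) : exists a, val y = a *: x by apply/asboolP; exact: valP y.
have [h hE] : exists h : {linear S -> E}, forall s, h s = j (val s).
  by exists (j \o submod_incl (set_submod sS)).
have jn0 m : m != 0 -> j m != 0.
  by apply: contraNneq => jm0; apply/eqP/injj; rewrite linear0.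
exists 1%N, (fun=> S), (fun=> E), (fun=> h), (fun=> idfun); split.
  move=> _; split.
    split; first by exists (Submod Sx); apply: contraNneq x0 => /(congr1 val) /= ->.
    move=> K [y Ky y0] z; have [c zE] := valS z.
    have [|a ay] := xP (val y).
      by apply: contraNneq y0 => y0; apply/eqP/val_inj.
    rewrite (_ : z = (c * a) *: y) ?rpredZ //; apply: val_inj.
    transitivity ((c * a) *: val y); first by rewrite zE -scalerA ay.
    exact/esym/(linearZZ (submod_incl (set_submod sS))).
  split=> //.
    by move=> y z; rewrite !hE => /injj; apply: val_inj.
  move=> K /essj[y Ky [y0 /asboolP[m mE]]].
  have [|a am] := xP m.
    by apply: contraNneq y0 => m0; rewrite -mE m0 linear0.
  exists (a *: y); first by rewrite rpredZ.
  rewrite -mE -linearZZ am; split; first exact: jn0.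
  by apply/asboolP; exists (Submod Sx); rewrite hE.
exists (fun e => fun=> e) => [f|e]; last by rewrite big_ord1.
by apply: functional_extensionality_dep => i; rewrite big_ord1 (ord1 i).
Qed.

(** Such an [x] generates a simple submodule: by essentiality, the copy of a simple [S i] inside [E]
    meets the image of [M]. *)
Lemma finitely_cogenerated_socle M : finitely_cogenerated M ->
  (exists y : M, y != 0) ->
  exists2 x : M, x != 0 & forall a, a *: x != 0 -> exists b, b *: (a *: x) = x.
Proof.
move=> [E [j [[injj injE essj] [n [S [F [h [u [SF bij]]]]]]]]] [y y0].
have jy0 : j y != 0.
  by apply: contraNneq y0 => jy0; apply/eqP/injj; rewrite linear0.
have [g gK Kg] := bij.
have [i _] : exists i : 'I_n, True.
  apply: contrapT => nex; move/eqP: jy0; apply.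
  by rewrite -(Kg (j y)) big1 // => i; case: nex; exists i.
have [[[s s0] simS] [injh _ _]] := SF i.
(* Tested on the families supported at [i], using injectivity of the sum map. *)
have injui : injective (u i).
  pose ins (a : F i) : forall k, F k := dfwith (fun k => 0 : F k) a.
  move=> a b ab; rewrite -[a](dfwith_in (fun k => 0 : F k)).
  rewrite -[b](dfwith_in (fun k => 0 : F k)) -/(ins a) -/(ins b).
  rewrite -(gK (ins a)) -(gK (ins b)); congr (g _ i).
  apply: eq_bigr => k _; rewrite /ins; have [<-|ik] := eqVneq i k.
    by rewrite !dfwith_in.
  by rewrite !dfwith_out.
pose w s := u i (h i s).
have lw : linear w by move=> a x z; rewrite /w !linearP.
have injw : injective w by move=> a b /injui /injh.
have [w' wE] := linear_exists lw.
have [|z /asboolP[t tz] [z0 /asboolP[x xz]]] := essj (linear_range w').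
  exists (w s); first by apply/asboolP; exists s; rewrite wE.
  by apply: contraNneq s0 => ws; apply/eqP/injw; rewrite -!wE linear0 wE.
exists x; first by apply: contraNneq z0 => x0; rewrite -xz x0 linear0.
move=> a ax0.
have at0 : a *: t != 0.
  apply: contraNneq ax0 => at0; apply/eqP/injj.
  by rewrite linear0 linearZZ xz -tz -linearZZ at0 linear0.
have sK : submod_set (fun v : S i => exists b, v = b *: (a *: t)).
  split; first by exists 0; rewrite scale0r.
  by move=> e _ _ [b ->] [c ->]; exists (e * b + c); rewrite scalerDl -(scalerA e).
have /simS/(_ t)/asboolP[b tb] : nonzero_submodule (set_submod sK).
  by exists (a *: t) => //; apply/asboolP; exists 1; rewrite scale1r.
exists b; apply: injj; rewrite (linearZZ j) (linearZZ j) xz -tz.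
by rewrite -(linearZZ w') -(linearZZ w') -tb.
Qed.

End FinitelyCogenerated.

(** * Purity and flatness over chain rings *)

(** Elementwise form of [chain_ring], equivalent to it through principal ideals. *)
Definition divisibility_total (R : comPzRingType) : Prop :=
  forall a b : R, (exists c, b = c * a) \/ (exists c, a = c * b).

(** * Diagonalization of matrices over a chain ring *)

Section Diagonalization.
Variable R : comNzRingType.
Hypothesis chR : divisibility_total R.

(** One-sided inverses of square matrices over a commutative ring are two-sided, by [mulmx1C]. *)
Definition diagonalizable_mx m n (A : 'M[R]_(m, n)) : Prop :=
  exists (L L' : 'M[R]_m) (D : 'M[R]_(m, n)) (U U' : 'M[R]_n),
    [/\ L *m L' = 1%:M, U *m U' = 1%:M, A = L *m D *m U
      & forall (i : 'I_m) (j : 'I_n), i != j :> nat -> D i j = 0].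

Lemma diagonalizable_equiv m n (A B : 'M[R]_(m, n)) (X X' : 'M_m) (Y Y' : 'M_n) :
  X *m X' = 1%:M -> Y *m Y' = 1%:M -> A = X *m B *m Y ->
  diagonalizable_mx B -> diagonalizable_mx A.
Proof.
move=> XX YY -> [L [L' [D [U [U' [LL UU -> Dd]]]]]].
exists (X *m L), (L' *m X'), D, (U *m Y), (Y' *m U'); split=> //.
- by rewrite !mulmxA -(mulmxA X) LL mulmx1.
- by rewrite !mulmxA -(mulmxA U) YY mulmx1.
- by rewrite !mulmxA.
Qed.

Lemma divisor_in_seq (s : seq R) :
  s != [::] -> exists2 a, a \in s & forall b, b \in s -> exists c, b = c * a.
Proof.
elim: s => // a [|a' s] IHs _.
  by exists a; rewrite ?mem_head // => b; rewrite inE => /eqP->; exists 1; rewrite mul1r.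
have [//|b bs bP] := IHs.
have [[c cP]|[c cP]] := chR a b.
  exists a; first exact: mem_head.
  move=> d; rewrite in_cons => /orP[/eqP->|/bP[e ->]]; first by exists 1; rewrite mul1r.
  by exists (e * c); rewrite -mulrA -cP.
exists b; first by rewrite in_cons bs orbT.
by move=> d; rewrite in_cons => /orP[/eqP->|/bP//]; exists c.
Qed.

(** No Euclidean descent: some entry [a] divides all the others, so once moved to the corner it
    clears its row and column. *)
Lemma chain_diagonalizable m n (A : 'M[R]_(m, n)) : diagonalizable_mx A.
Proof.
elim: m n A => [|m IHm] n A.
  exists 1%:M, 1%:M, A, 1%:M, 1%:M; rewrite !mulmx1 mul1mx.
  by split=> // -[].
case: n A => [|n] A.
  exists 1%:M, 1%:M, A, 1%:M, 1%:M; rewrite !mulmx1 mul1mx.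
  by split=> // i [].
have [|a /mapP[[i j] _ /= aE] aP] :=
    @divisor_in_seq [seq A k.1 k.2 | k <- enum {: 'I_m.+1 * 'I_n.+1}].
  by rewrite -size_eq0 size_map -cardE card_prod !card_ord.
have {}aP k l : exists c, A k l = c * a.
  by apply: aP; apply/mapP; exists (k, l); rewrite ?mem_enum.
pose A1 := xrow i 0 (xcol j 0 A).
have tp2 p (k l : 'I_p) : tperm_mx k l *m tperm_mx k l = 1%:M :> 'M[R]_p.
  by rewrite -perm_mxM tperm2 perm_mx1.
apply: (diagonalizable_equiv (tp2 _ i 0) (tp2 _ j 0) (B := A1)).
  by rewrite /A1 xrowE xcolE !mulmxA tp2 mul1mx -mulmxA tp2 mulmx1.
have A100 : A1 0 0 = a by rewrite !mxE !tpermR.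
have {}aP k l : exists c, A1 k l = c * a by rewrite !mxE; apply: aP.
move: A1 A100 aP => {aE A i j} A A00 aP.
have /choice[f fP] : forall kl : 'I_m.+1 * 'I_n.+1, exists c, A kl.1 kl.2 = c * a.
  by move=> [k l]; apply: aP.
pose c' : 'cV[R]_m := \col_k f (rshift 1 k, 0).
pose r' : 'rV[R]_n := \row_k f (0, rshift 1 k).
(* What clearing leaves: [c'] and [r'] hold the quotients by [a] of the rest of the first column and
   first row. *)
pose B := drsubmx (A : 'M_(1 + m, 1 + n)) - a *: (c' *m r').
have [L [L' [D [U [U' [LL UU BE Dd]]]]]] := IHm n B.
pose Xl : 'M[R]_(1 + m) := block_mx 1%:M 0 c' 1%:M.
pose Xl' : 'M[R]_(1 + m) := block_mx 1%:M 0 (- c') 1%:M.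
pose Yr : 'M[R]_(1 + n) := block_mx 1%:M r' 0 1%:M.
pose Yr' : 'M[R]_(1 + n) := block_mx 1%:M (- r') 0 1%:M.
pose Bd : 'M[R]_(1 + m, 1 + n) := block_mx a%:M 0 0 B.
have simp := (mulmx0, mul0mx, mulmx1, mul1mx, addr0, add0r).
apply: (@diagonalizable_equiv m.+1 n.+1 A Bd Xl Xl' Yr Yr').
- by rewrite /Xl /Xl' (@mulmx_block _ 1 _ 1 _ 1) !simp subrr -scalar_mx_block.
- by rewrite /Yr /Yr' (@mulmx_block _ 1 _ 1 _ 1) !simp addNr -scalar_mx_block.
- rewrite /Xl /Yr /Bd (@mulmx_block _ 1 _ 1 _ 1) !simp (@mulmx_block _ 1 _ 1 _ 1) !simp.
  have -> : a%:M = @ulsubmx _ 1 m 1 n A.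
    apply/matrixP => k l; rewrite !ord1 !mxE eqxx mulr1n -A00.
    by congr (A _ _); apply: val_inj.
  have -> : ulsubmx (A : 'M_(1 + m, 1 + n)) *m r' = ursubmx (A : 'M_(1 + m, 1 + n)).
    apply/matrixP => k l; rewrite !ord1 !mxE big_ord1 !mxE.
    have := fP (0, rshift 1 l); rewrite -A00 mulrC /= => e.
    by rewrite (_ : lshift m 0 = 0) 1?(_ : lshift n 0 = 0) ?e //; apply: val_inj.
  have -> : c' *m ulsubmx (A : 'M_(1 + m, 1 + n)) = dlsubmx (A : 'M_(1 + m, 1 + n)).
    apply/matrixP => k l; rewrite !ord1 !mxE big_ord1 !mxE.
    have := fP (rshift 1 k, 0); rewrite -A00 /= => e.
    by rewrite (_ : lshift m 0 = 0) 1?(_ : lshift n 0 = 0) ?e //; apply: val_inj.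
  have -> : dlsubmx (A : 'M_(1 + m, 1 + n)) *m r' = a *: (c' *m r').
    apply/matrixP => k l; rewrite !mxE !big_ord1 !mxE mulrA; congr (_ * _).
    rewrite mulrC -(fP (_, 0)) /=; congr (A _ _); exact: val_inj.
  by rewrite subrKC -[LHS](@submxK _ 1 m 1 n).
exists (block_mx 1%:M 0 0 L : 'M_(1 + m)), (block_mx 1%:M 0 0 L' : 'M_(1 + m)),
  (block_mx a%:M 0 0 D : 'M_(1 + m, 1 + n)), (block_mx 1%:M 0 0 U : 'M_(1 + n)),
  (block_mx 1%:M 0 0 U' : 'M_(1 + n)); split.
- by rewrite (@mulmx_block _ 1 _ 1 _ 1) !simp LL -scalar_mx_block.
- by rewrite (@mulmx_block _ 1 _ 1 _ 1) !simp UU -scalar_mx_block.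
- by rewrite (@mulmx_block _ 1 _ 1 _ 1) !simp (@mulmx_block _ 1 _ 1 _ 1) !simp -BE.
move=> i j; case: (@split_ordP 1 m i) => i' ->; case: (@split_ordP 1 n j) => j' -> ij.
- by rewrite !ord1 in ij.
- by rewrite (@block_mxEur _ 1 m 1 n) mxE.
- by rewrite (@block_mxEdl _ 1 m 1 n) mxE.
- by rewrite (@block_mxEdr _ 1 m 1 n) Dd.
Qed.

Section ScaleMatrix.
Variable M : lmodType R.

Definition mxact m n (A : 'M[R]_(m, n)) (x : 'I_n -> M) : 'I_m -> M :=
  fun i => \sum_j A i j *: x j.

Lemma mxactM m n p (A : 'M[R]_(m, n)) (B : 'M[R]_(n, p)) x :
  mxact (A *m B) x = mxact A (mxact B x).
Proof.
apply/funext => i; rewrite /mxact.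
under [RHS]eq_bigr => j _ do rewrite scaler_sumr.
rewrite exchange_big; apply: eq_bigr => k _; rewrite mxE scaler_suml.
by apply: eq_bigr => j _; rewrite scalerA.
Qed.

Lemma mxact1 n (x : 'I_n -> M) : mxact 1%:M x = x.
Proof.
apply/funext => i; rewrite /mxact (bigD1 i) //= mxE eqxx scale1r.
by rewrite big1 ?addr0 // => j ji; rewrite mxE eq_sym (negPf ji) scale0r.
Qed.

End ScaleMatrix.

Lemma mxact_diag (M : lmodType R) m n (D : 'M[R]_(m, n)) (x : 'I_n -> M) (i : 'I_m) :
  (forall (i : 'I_m) (j : 'I_n), i != j :> nat -> D i j = 0) ->
  (exists2 j : 'I_n, i = j :> nat & mxact D x i = D i j *: x j) \/
  mxact D x i = 0 /\ (n <= i)%N.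
Proof.
move=> Dd; have [ni|ni] := leqP n i.
  right; split=> //; rewrite /mxact big1 // => j _; rewrite Dd ?scale0r //.
  by rewrite gtn_eqF // (leq_trans (ltn_ord j)).
left; exists (Ordinal ni) => //; rewrite /mxact (bigD1 (Ordinal ni)) //= big1 ?addr0 //.
by move=> j ji; rewrite Dd ?scale0r //; apply: contraNneq ji => ji; apply/eqP/val_inj.
Qed.

End Diagonalization.

(** * Derivations in tensor products *)

Section TensorFacts.
Variable R : comPzRingType.
Implicit Types M N E : lmodType R.

(** Universal property of the tensor product on formal sums; it extracts consequences from a
    vanishing sum. Since [A] is a mere commutative monoid, [b 0 0 = 0] does not follow from
    additivity. *)
Lemma tensor_bilinear_sum M N (A : nmodType) (b : M -> N -> A) :
  (forall y, {morph b^~ y : x x' / x + x'}) ->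
  (forall x, {morph b x : y y' / y + y'}) ->
  (forall a x y, b (a *: x) y = b x (a *: y)) ->
  b 0 0 = 0 ->
  forall s t, tensor_rel s t -> \sum_(p <- s) b p.1 p.2 = \sum_(p <- t) b p.1 p.2.
Proof.
move=> bl br bZ b0 s t;
  elim=> {s t}//= [s t u _ -> //|s s' t t' _ ss _ tt|s t||x x' y|x y y'|a x y];
  rewrite ?big_cat ?big_cons ?big_nil /= ?addr0 //.
- by rewrite ss tt.
- by rewrite addrC.
- by rewrite bl.
- by rewrite br.
Qed.

Lemma tensor_rel_swap M N (s t : seq (M * N)) : tensor_rel s t ->
  tensor_rel [seq (p.2, p.1) | p <- s] [seq (p.2, p.1) | p <- t].
Proof.
elim=> {s t} [s|s t _|s t u _ st _|s s' t t' _ ss' _ tt'|s t||x x' y|x y y'|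
              a x y] /=.
- exact: tensor_refl.
- exact: tensor_sym.
- exact: tensor_trans st.
- by rewrite !map_cat; apply: tensor_cat.
- by rewrite !map_cat; apply: tensor_catC.
- exact: tensor_zero.
- exact: tensor_addr.
- exact: tensor_addl.
- by apply: tensor_sym; apply: tensor_scale.
Qed.

Definition satisfies (X : Type) M (phi : X -> M) (l : seq (R * X)) : Prop :=
  \sum_(p <- l) p.1 *: phi p.2 = 0.

(* A derivation of [tensor_rel s t] involves only finitely many linear
   relations [L] between elements of [M]. *)
Lemma tensor_rel_relations M N (s t : seq (M * N)) : tensor_rel s t ->
  exists L : seq (seq (R * M)),
    (forall l, l \in L -> satisfies id l) /\
    forall M' (phi : M -> M'), (forall l, l \in L -> satisfies phi l) ->
      tensor_rel [seq (phi p.1, p.2) | p <- s] [seq (phi p.1, p.2) | p <- t].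
Proof.
elim=> {s t} [s|s t _ [L [LM LP]]|s t u _ [L [LM LP]] _ [L' [LM' LP']]|
  s s' t t' _ [L [LM LP]] _ [L' [LM' LP']]|s t||x x' y|x y y'|a x y] /=.
- by exists [::]; split=> // M' phi _; apply: tensor_refl.
- by exists L; split=> // M' phi /LP; apply: tensor_sym.
- exists (L ++ L'); split=> [l|M' phi h].
    by rewrite mem_cat => /orP[/LM|/LM'].
  apply: tensor_trans (LP _ _ _) (LP' _ _ _) => l Ll; apply: h.
    by rewrite mem_cat Ll.
  by rewrite mem_cat Ll orbT.
- exists (L ++ L'); split=> [l|M' phi h].
    by rewrite mem_cat => /orP[/LM|/LM'].
  rewrite !map_cat; apply: tensor_cat; [apply: LP|apply: LP'] => l Ll; apply: h.
    by rewrite mem_cat Ll.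
  by rewrite mem_cat Ll orbT.
- by exists [::]; split=> // M' phi _; rewrite !map_cat; apply: tensor_catC.
- exists [:: [:: (1, 0)]]; split=> [l|M' phi h].
    by rewrite inE => /eqP->; rewrite /satisfies big_seq1 scale1r.
  have := h _ (mem_head _ _); rewrite /satisfies big_seq1 scale1r /= => ->.
  exact: tensor_zero.
- exists [:: [:: (1, x + x'); (-1, x); (-1, x')]]; split=> [l|M' phi h].
    rewrite inE => /eqP->; rewrite /satisfies !big_cons big_nil /=.
    by rewrite !scaleN1r scale1r addr0 -opprD subrr.
  have := h _ (mem_head _ _); rewrite /satisfies !big_cons big_nil /=.
  rewrite !scaleN1r scale1r addr0 -opprD => /eqP; rewrite subr_eq0 => /eqP->.
  exact: tensor_addl.
- by exists [::]; split=> // M' phi _; apply: tensor_addr.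
- exists [:: [:: (1, a *: x); (- a, x)]]; split=> [l|M' phi h].
    rewrite inE => /eqP->; rewrite /satisfies !big_cons big_nil /=.
    by rewrite scaleNr scale1r addr0 subrr.
  have := h _ (mem_head _ _); rewrite /satisfies !big_cons big_nil /=.
  rewrite scaleNr scale1r addr0 => /eqP; rewrite subr_eq0 => /eqP->.
  exact: tensor_scale.
Qed.

Lemma tensor_rel_addN M N (s t : seq (M * N)) :
  tensor_rel (s ++ [seq (- p.1, p.2) | p <- t]) [::] <-> tensor_rel s t.
Proof.
rewrite -!tensor_piP -!pi_tensor_add.
have -> : [seq (- p.1, p.2) | p <- t] = [seq (-1 *: p.1, p.2) | p <- t].
  by apply: eq_map => p; rewrite scaleN1r.
rewrite -pi_tensor_scal -[tensor_scal _ _]/(- \pi_(tensor M N) t).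
have sub0 (x y : tensor M N) : x - y = 0 <-> x = y.
  by split=> /eqP; [rewrite subr_eq0|rewrite -subr_eq0] => /eqP.
exact: sub0.
Qed.

Lemma tensor_map_inj M M' N (f : {linear M -> M'}) :
  (forall s : seq (M * N), tensor_rel [seq (f p.1, p.2) | p <- s] [::] ->
     tensor_rel s [::]) ->
  injective (tensor_map f (@idfun N)).
Proof.
move=> H t t'; rewrite -[t]reprK -[t']reprK !pi_tensor_map => /tensor_piP tt.
apply/tensor_piP/tensor_rel_addN/H; rewrite map_cat.
have -> : [seq (f p.1, p.2) | p <- [seq (- p.1, p.2) | p <- repr t']] =
    [seq (- p.1, p.2) | p <- [seq (f p.1, p.2) | p <- repr t']].
  by rewrite -!map_comp; apply: eq_map => p /=; rewrite linearN.
exact/tensor_rel_addN.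
Qed.

End TensorFacts.

(** * Purity as injectivity, and relative divisibility *)

Section Purity.
Variable R : comPzRingType.
Implicit Types M N E : lmodType R.

Lemma tensor_piE M N (s : seq (M * N)) :
  \pi_(tensor M N) s = \sum_(p <- s) \pi_(tensor M N) [:: (p.1, p.2)].
Proof.
elim: s => [|[x y] s IHs]; first by rewrite big_nil.
by rewrite big_cons -IHs -[LHS](pi_tensor_add [:: (x, y)] s).
Qed.

(** With [W] the image coming from [F], the map [b] sends [(x, n)] to the class modulo [W] of the
    elementary tensor of [x] and [n]. It depends only on [x] modulo [F], so a tensor killed over
    [quotmod F] lies in [W]. *)
Lemma tensor_right_exact E (F : submodClosed E) N (t : tensor E N) :
  tensor_map (quot_proj F) (@idfun N) t = 0 ->
  exists u, tensor_map (submod_incl F) (@idfun N) u = t.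
Proof.
pose T : lmodType R := tensor E N.
pose W (v : T) := exists u, tensor_map (submod_incl F) (@idfun N) u = v.
have sW : submod_set W.
  split; first by exists (\pi_(tensor _ _) [::]); rewrite pi_tensor_map.
  move=> a _ _ [u <-] [v <-].
  exists (\pi_(tensor _ _) ([seq (a *: p.1, p.2) | p <- repr u] ++ repr v)).
  rewrite -[u in RHS]reprK -[v in RHS]reprK !pi_tensor_map.
  rewrite -[a *: _]/(tensor_scal a _) pi_tensor_scal -[RHS]/(tensor_add _ _).
  rewrite pi_tensor_add map_cat -!map_comp; congr (\pi_(tensor _ _) (_ ++ _)).
pose e x n : T := \pi_(tensor E N) [:: (x, n)].
have eDl n : {morph e^~ n : x y / x + y}.
  by move=> x y; rewrite /e -[RHS]/(tensor_add _ _) pi_tensor_add; apply/tensor_piP/tensor_addl.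
have eDr x : {morph e x : m n / m + n}.
  by move=> m n; rewrite /e -[RHS]/(tensor_add _ _) pi_tensor_add; apply/tensor_piP/tensor_addr.
have eZ a x n : e (a *: x) n = e x (a *: n) by apply/tensor_piP/tensor_scale.
pose Q := quot_proj (set_submod sW).
have eF x n : x \in F -> Q (e x n) = 0.
  move=> Fx; rewrite -(linear0 Q); apply/quot_piP/set_submodP; rewrite subr0.
  by exists (\pi_(tensor _ _) [:: (Submod Fx, n)]); rewrite pi_tensor_map.
pose b (x : quotmod F) n := Q (e (repr x) n).
have bE x n : b (quot_proj F x) n = Q (e x n).
  rewrite /b -[repr _ in LHS](subrK x) eDl linearD eF ?add0r //; exact: quot_reprB.
have bl n : {morph b^~ n : x y / x + y}.
  move=> x y; have [u ->] := quot_projP x; have [v ->] := quot_projP y.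
  by rewrite -linearD !bE eDl linearD.
have br x : {morph b x : m n / m + n} by move=> m n; rewrite /b eDr linearD.
have bZ a x n : b (a *: x) n = b x (a *: n).
  by have [u ->] := quot_projP x; rewrite -linearZZ !bE eZ.
have b0 : b 0 0 = 0.
  by apply: (addrI (b 0 0)); rewrite -br !addr0.
rewrite -[t]reprK pi_tensor_map => /tensor_piP/(tensor_bilinear_sum bl br bZ b0).
rewrite big_nil big_map /= => h.
have : Q (\pi_(tensor E N) (repr t)) = Q 0.
  rewrite linear0 tensor_piE linear_sum -[RHS]h.
  by apply: eq_bigr => p _; rewrite bE.
by move=> /quot_piP; rewrite subr0 => /set_submodP.
Qed.

(* Tensor products are right exact, so only injectivity is at stake. *)
Lemma pure_submoduleP E (F : submodClosed E) :
  pure_submodule F <->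
  forall N, injective (tensor_map (submod_incl F) (@idfun N)).
Proof.
split=> [pF N|injF N]; first by have [] := pF N.
split=> [|t|t]; [exact: injF| |].
  split; first exact: tensor_right_exact.
  move=> [u <-]; rewrite pi_tensor_map -map_comp.
  rewrite -[RHS]/(\pi_(tensor (quotmod F) N) [::]); apply/tensor_piP.
  elim: (repr u) => [|[x n] s IHs] /=; first exact: tensor_refl.
  rewrite (_ : quot_proj_fun F (submod_val x) = 0).
    exact: (tensor_cat (tensor_rel0 _ n) IHs).
  rewrite -[LHS]/(quot_proj F (val x)) -(linear0 (quot_proj F)); apply/quot_piP.
  by rewrite subr0; apply: valP.
exists (\pi_(tensor _ _) [seq (repr p.1, p.2) | p <- repr t]).
rewrite pi_tensor_map -map_comp -[RHS]reprK; congr (\pi_(tensor _ _) _).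
by rewrite -[RHS]map_id; apply: eq_map => -[x n] /=; rewrite /quot_proj_fun reprK.
Qed.

(** RD-purity: the intersection of [F] with [s E] is [s F]. *)
Definition relatively_divisible E (F : submodClosed E) : Prop :=
  forall s x, x \in F -> (exists y, x = s *: y) -> exists2 y, y \in F & x = s *: y.

Lemma scale_range_submod M (s : R) : submod_set (fun x : M => exists y, x = s *: y).
Proof.
split; first by exists 0; rewrite scaler0.
move=> a _ _ [x ->] [y ->]; exists (a *: x + y).
by rewrite scalerDr !scalerA mulrC.
Qed.

(** Tensor with [R / s R]: the element given by [x = s *: y] dies over [E], hence over [F], where it
    is detected in [F / s F]. *)
Lemma pure_relatively_divisible E (F : submodClosed E) :
  pure_submodule F -> relatively_divisible F.
Proof.
move=> /pure_submoduleP pF s x Fx [y xy].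
pose Rs := quotmod (set_submod (@scale_range_submod R^o s)).
pose pr := quot_proj (set_submod (@scale_range_submod R^o s)).
have pr0 (r : R) : pr (s * r) = 0.
  by rewrite -(linear0 pr); apply/quot_piP/set_submodP; rewrite subr0; exists r.
pose pF' := quot_proj (set_submod (@scale_range_submod (submod F : lmodType R) s)).
have pF'0 (z : submod F) : pF' (s *: z) = 0.
  by rewrite -(linear0 pF'); apply/quot_piP/set_submodP; rewrite subr0; exists z.
pose X := Submod Fx : submod F.
have : \pi_(tensor (submod F) Rs) [:: (X, pr 1)] = \pi_(tensor _ _) [::].
  apply: pF; rewrite !pi_tensor_map; apply/tensor_piP => /=; rewrite xy.
  apply: tensor_trans (tensor_scale s y (pr 1)) _.
  rewrite -linearZZ -[s *: _]/(s * 1) pr0 -(scale0r (0 : Rs)).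
  apply: tensor_trans (tensor_sym (tensor_scale 0 y 0)) _.
  by rewrite scale0r; apply: tensor_rel0.
pose b (z : submod F) (r : Rs) := pF' ((repr r : R) *: z).
have bE z (r : R^o) : b z (pr r) = pF' ((r : R) *: z).
  have /set_submodP[u uE] := @quot_reprB _ _ (set_submod (@scale_range_submod R^o s)) r.
  rewrite /b (_ : repr (pr r) = s * u + r :> R); last by apply/eqP; rewrite -subr_eq uE.
  by rewrite scalerDl -scalerA linearD pF'0 add0r.
have bl r : {morph b^~ r : z w / z + w}.
  by move=> z w; rewrite /b scalerDr linearD.
have br z : {morph b z : r q / r + q}.
  move=> r q; have [u ->] := quot_projP r; have [v ->] := quot_projP q.
  by rewrite -linearD !bE scalerDl linearD.
have bZ a z r : b (a *: z) r = b z (a *: r).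
  by have [u ->] := quot_projP r; rewrite -linearZZ !bE scalerA mulrC.
have b0 : b 0 0 = 0 by rewrite /b scaler0 linear0.
move=> /tensor_piP/(tensor_bilinear_sum bl br bZ b0).
rewrite big_nil big_seq1 /= bE scale1r -(linear0 pF') => /quot_piP/set_submodP[z].
by rewrite subr0 => Xz; exists (val z); [exact: valP|exact: (congr1 val Xz)].
Qed.

End Purity.

(** * Over a chain ring, relative divisibility implies purity *)

Section ChainPurity.
Variable R : comNzRingType.
Implicit Types M N E : lmodType R.

Lemma collect_relation (X : eqType) M (x0 : X) (V : seq X) (phi : X -> M)
    (l : seq (R * X)) :
  uniq V -> {subset [seq p.2 | p <- l] <= V} ->
  \sum_(p <- l) p.1 *: phi p.2 =
    \sum_(j < size V) (\sum_(p <- l | p.2 == nth x0 V j) p.1) *: phi (nth x0 V j).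
Proof.
move=> uV lV; transitivity (\sum_(e <- V) (\sum_(p <- l | p.2 == e) p.1) *: phi e);
  last by rewrite (big_nth x0) big_mkord.
under [RHS]eq_bigr => e _ do rewrite scaler_suml big_mkcond.
rewrite exchange_big /= [LHS]big_seq [RHS]big_seq; apply: eq_bigr => p pl.
rewrite (bigD1_seq p.2) ?lV ?map_f //= eqxx big1 ?addr0 // => e.
by rewrite eq_sym => /negPf->.
Qed.

Definition relation_mx (X : eqType) (x0 : X) (V : seq X) (L : seq (seq (R * X))) :
  'M[R]_(size L, size V) :=
  \matrix_(i, j) \sum_(p <- nth [::] L i | p.2 == nth x0 V j) p.1.

Lemma mxact_relation (X : eqType) M (x0 : X) (V : seq X) (L : seq (seq (R * X)))
    (phi : X -> M) :
  uniq V -> (forall l, l \in L -> {subset [seq p.2 | p <- l] <= V}) ->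
  forall i, mxact (relation_mx x0 V L) (fun j => phi (nth x0 V j)) i =
    \sum_(p <- nth [::] L i) p.1 *: phi p.2.
Proof.
move=> uV LV i; rewrite (@collect_relation _ _ x0 V) //; last exact/LV/mem_nth.
by apply: eq_bigr => j _; rewrite mxE.
Qed.

Hypothesis chR : divisibility_total R.

(** Diagonalization decouples the system into equations in one unknown, each solved in [F] by
    relative divisibility. *)
Lemma relatively_divisible_solve E (F : submodClosed E) m n (A : 'M[R]_(m, n))
    (x : 'I_n -> E) :
  relatively_divisible F -> (forall i, mxact A x i \in F) ->
  exists y : 'I_n -> E, (forall j, y j \in F) /\ mxact A y = mxact A x.
Proof.
move=> rdF AxF.
have [L [L' [D [U [U' [LL UU AE Dd]]]]]] := chain_diagonalizable chR A.
have actF p q (B : 'M[R]_(p, q)) (z : 'I_q -> E) :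
    (forall i, z i \in F) -> forall i, mxact B z i \in F.
  by move=> zF i; rewrite /mxact rpred_sum // => j _; rewrite rpredZ.
pose w := mxact U x.
have DwE : mxact D w = mxact L' (mxact A x).
  by rewrite AE !mxactM -(mxactM L' L) (mulmx1C LL) mxact1.
have DwF i : mxact D w i \in F by rewrite DwE; apply: actF.
have /choice[y yP] : forall j : 'I_n, exists y, y \in F /\
    forall i : 'I_m, i = j :> nat -> D i j *: y = D i j *: w j.
  (* A column beyond the last row carries no equation, and its unknown is set to 0. *)
  move=> j; have [jm|jm] := ltnP j m; last first.
    exists 0; split; first exact: rpred0.
    move=> i ij; move: jm; rewrite -ij leqNgt; case/negP; apply: ltn_ord.
  pose i := Ordinal jm; have Dij : D i j *: w j \in F.
    have [[k ik]|[_]] := mxact_diag w i Dd; last by rewrite leqNgt (ltn_ord j : (i < n)%N).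
    by rewrite (_ : k = j) => [<-|]; [exact: DwF|apply: val_inj; rewrite /= -ik].
  have [y Fy yE] := rdF _ _ Dij (ex_intro _ (w j) erefl).
  exists y; split=> // i' ij; rewrite (_ : i' = i) //; exact: val_inj.
exists (mxact U' y); split; first by apply: actF => j; have [] := yP j.
rewrite AE !mxactM -(mxactM U U') UU mxact1; congr mxact.
apply/funext => i; have [[j ij ->]|[-> ni]] := mxact_diag y i Dd.
  have [[k ik ->]|[_]] := mxact_diag w i Dd; last by rewrite leqNgt ij (ltn_ord j).
  rewrite (_ : k = j) ?(yP j).2 //; apply: val_inj; by rewrite /= -ik.
have [[k ik _]|[-> //]] := mxact_diag w i Dd.
by move: ni; rewrite leqNgt ik (ltn_ord k).
Qed.

(** The elements outside [F] in the relations behind a derivation over [E] are the unknowns of a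
    linear system solvable in [E]. Replacing them by a solution in [F] turns the derivation into one
    over [F]. *)
Lemma relatively_divisible_pure E (F : submodClosed E) :
  relatively_divisible F -> pure_submodule F.
Proof.
move=> rdF; apply/pure_submoduleP => N; apply: tensor_map_inj => s.
move=> /tensor_rel_relations[L [LE LP]].
(* The terms with unknowns; the discarded ones make up the right-hand sides, which lie in [F]. *)
pose L' := [seq [seq p <- l | p.2 \notin F] | l <- L].
pose V := undup (flatten [seq [seq p.2 | p <- l] | l <- L']).
have LV l : l \in L' -> {subset [seq p.2 | p <- l] <= V}.
  by move=> lL e el; rewrite mem_undup; apply/flattenP;
    exists [seq p.2 | p <- l] => //; apply: map_f.
pose A := relation_mx 0 V L'.
have splitF (phi : E -> E) l : \sum_(p <- l) p.1 *: phi p.2 =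
    \sum_(p <- l | p.2 \in F) p.1 *: phi p.2 +
    \sum_(p <- [seq p <- l | p.2 \notin F]) p.1 *: phi p.2.
  by rewrite (bigID (fun p => p.2 \in F)) /= big_filter.
have nthL' i : (i < size L)%N ->
    nth [::] L' i = [seq p <- nth [::] L i | p.2 \notin F].
  by move=> iL; rewrite (nth_map [::]).
have [i|y [yF yA]] := @relatively_divisible_solve E F _ _ A (fun j => nth 0 V j) rdF.
  rewrite (@mxact_relation _ _ _ V L' id) ?undup_uniq //.
  have iL : (i < size L)%N by have := ltn_ord i; rewrite [X in (_ < X)%N]size_map.
  rewrite nthL' //.
  have := LE _ (mem_nth [::] iL); rewrite /satisfies (splitF id) addrC => /eqP.
  rewrite addr_eq0 => /eqP->; rewrite submodN rpred_sum // => p Fp; exact: rpredZ.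
(* [phi] fixes [F] and substitutes the solution; the default 0 keeps its values in [F]. *)
pose phi (e : E) : E := if e \in F then e else
  if insub (index e V) is Some j then y j else 0.
have phiV (j : 'I_(size V)) : phi (nth 0 V j) = y j.
  have : nth 0 V j \notin F.
    have : nth 0 V j \in V by exact: mem_nth.
    rewrite mem_undup => /flattenP[_ /mapP[_ /mapP[l _ ->] ->]].
    by move=> /mapP[p]; rewrite mem_filter => /andP[pF _] ->.
  rewrite /phi => /negPf->; rewrite index_uniq ?undup_uniq //.
  by rewrite valK.
have phiF e : phi e \in F.
  by rewrite /phi; case: ifP => // _; case: insub => [j|] //; apply: rpred0.
have phi_id e : e \in F -> phi e = e by rewrite /phi => ->.
have phiL l : l \in L -> satisfies phi l.
  move=> lL; rewrite /satisfies splitF -[RHS](LE l lL) (splitF id); congr (_ + _).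
    by apply: eq_bigr => p /phi_id ->.
  pose i := index l L; have il : (i < size L')%N by rewrite size_map index_mem.
  have <- : nth [::] L' i = [seq p <- l | p.2 \notin F].
    by rewrite nthL' ?nth_index // index_mem.
  rewrite -(mxact_relation 0 phi _ LV (Ordinal il)) ?undup_uniq //.
  rewrite -[RHS](mxact_relation 0 id _ LV (Ordinal il)) ?undup_uniq //.
  rewrite -/A -[RHS](congr1 (fun f => f _) yA); congr mxact.
  by apply/funext => j; apply: phiV.
pose phi' e : submod F := Submod (phiF e).
have := LP _ phi' _; rewrite -map_comp.
rewrite (_ : map _ s = s); last first.
  rewrite -[RHS]map_id; apply: eq_map => -[x n] /=; congr pair.
  by apply: val_inj => /=; apply/phi_id/(valP x).
apply=> l /phiL /= h; apply: val_inj.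
by rewrite -[LHS]/(submod_incl F _) linear_sum -[RHS]h; apply: eq_bigr => p _; rewrite linearZZ.
Qed.

End ChainPurity.

(** * Flatness: a necessary condition and a sufficient one *)

Section Flatness.
Variable R : comPzRingType.
Implicit Types M N E : lmodType R.

(** Flatness puts an [x] killed by [s] into [(0 : s) N], which [W] contains: the tensor of [s] and
    [x] dies over [R], hence over [s R], and [(s * r, n) |-> r *: n] is well defined modulo [W]. *)
Lemma flat_torsion N (s : R) (x : N) (W : set N) : submod_set W ->
  (forall r z, s * r = 0 -> W (r *: z)) -> flat N -> s *: x = 0 -> W x.
Proof.
move=> sW WP fN sx.
pose I := set_submod (@scale_range_submod R R^o s).
have Is : (s : R^o) \in I by apply/set_submodP; exists 1; rewrite /GRing.scale /= mulr1.
have inj_I : injective (submod_incl I) by move=> u v; apply: val_inj.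
have /choice[c cE] : forall z : submod I, exists c : R, (val z : R) = s * c.
  by move=> z; have /set_submodP := valP z.
pose pW := quot_proj (set_submod sW).
have pWE r r' (n : N) : s * r = s * r' -> pW (r *: n) = pW (r' *: n).
  move=> sr; apply/quot_piP/set_submodP; rewrite -scalerBl; apply: WP.
  by rewrite mulrBr sr subrr.
pose b (z : submod I) (n : N) := pW (c z *: n).
have bl n : {morph b^~ n : z w / z + w}.
  move=> z w; rewrite /b -linearD -scalerDl; apply: pWE.
  by rewrite mulrDr -!cE.
have br z : {morph b z : m n / m + n} by move=> m n; rewrite /b scalerDr linearD.
have bZ a z n : b (a *: z) n = b z (a *: n).
  rewrite /b scalerA; apply: pWE; rewrite mulrA -!cE mulrC.
  exact: (linearZZ (submod_incl I)).
have b0 : b 0 0 = 0 by rewrite /b scaler0 linear0.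
have : \pi_(tensor (submod I) N) [:: (Submod Is, x)] = \pi_(tensor _ _) [::].
  apply: (fN _ _ _ inj_I); rewrite !pi_tensor_map; apply/tensor_piP => /=.
  have -> : s = s *: (1 : R^o) by rewrite /GRing.scale /= mulr1.
  apply: tensor_trans (tensor_scale s (1 : R^o) x) _; rewrite sx.
  rewrite -(scale0r (0 : N)); apply: tensor_trans (tensor_sym (tensor_scale 0 _ 0)) _.
  by rewrite scale0r; apply: tensor_rel0.
move=> /tensor_piP/(tensor_bilinear_sum bl br bZ b0); rewrite big_nil big_seq1 /=.
have -> : b (Submod Is) x = pW (1 *: x) by apply: pWE; rewrite -cE mulr1.
by rewrite -(linear0 pW) => /quot_piP/set_submodP; rewrite subr0 scale1r.
Qed.

(** A finite dual basis, so [N] is finitely generated projective; vanishing of a tensor can be read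
    off the coordinates [c i]. *)
Lemma finite_coordinates_flat N n (c : 'I_n -> {linear N -> R^o}) (e : 'I_n -> N) :
  (forall x, x = \sum_i (c i x : R) *: e i) -> flat N.
Proof.
move=> ce A B f injf; apply: tensor_map_inj => s.
have coordE (M : lmodType R) (t : seq (M * N)) i : tensor_rel t [::] ->
    \sum_(p <- t) (c i p.2 : R) *: p.1 = 0.
  pose b (y : M) (x : N) := (c i x : R) *: y.
  have bl x : {morph b^~ x : y z / y + z} by move=> y z; rewrite /b scalerDr.
  have br y : {morph b y : x z / x + z} by move=> x z; rewrite /b linearD scalerDl.
  have bZ a y x : b (a *: y) x = b y (a *: x).
    by rewrite /b (linearZZ (c i)) scalerA mulrC.
  have b0 : b 0 0 = 0 by rewrite /b scaler0.
  by move=> /(tensor_bilinear_sum bl br bZ b0); rewrite big_nil.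
move=> fs; apply/tensor_piP; rewrite tensor_piE.
pose el (x : A) (m : N) : tensor A N := \pi_(tensor A N) [:: (x, m)].
have elDl m : {morph el^~ m : x y / x + y}.
  by move=> x y; rewrite /el -[RHS]/(tensor_add _ _) pi_tensor_add;
    apply/tensor_piP/tensor_addl.
have elDr x : {morph el x : m m' / m + m'}.
  by move=> m m'; rewrite /el -[RHS]/(tensor_add _ _) pi_tensor_add;
    apply/tensor_piP/tensor_addr.
have el0l m : el 0 m = 0 by apply/tensor_piP; apply: tensor_rel0.
have el0r x : el x 0 = 0 by apply: (addrI (el x 0)); rewrite -elDr !addr0.
transitivity (\sum_(p <- s) \sum_i el ((c i p.2 : R) *: p.1) (e i)).
  apply: eq_bigr => p _; rewrite -/(el p.1 p.2) {1}(ce p.2).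
  rewrite (big_morph (el p.1) (elDr _) (el0r _)); apply: eq_bigr => i _.
  by apply/esym/tensor_piP/tensor_scale.
rewrite exchange_big /= big1 // => i _.
rewrite -(big_morph (el^~ (e i)) (elDl _) (el0l _)).
have -> : \sum_(p <- s) (c i p.2 : R) *: p.1 = 0; last exact: el0l.
apply: injf; rewrite linear0 linear_sum -[RHS](coordE _ _ i fs) big_map.
by apply: eq_bigr => p _; rewrite linearZZ.
Qed.

End Flatness.

(** * Torsion-free modules over a chain ring are flat *)

Section TorsionFree.
Variable R : comNzRingType.
Hypothesis chR : divisibility_total R.

(** In the manner of Lazard: the finitely many relations used in [N] already hold in a finite free
    module [Fr] mapping to [N], and [Fr] is flat. *)
Lemma torsion_free_flat (N : lmodType R) :
  (forall a (x : N), a *: x = 0 -> a = 0 \/ x = 0) -> flat N.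
Proof.
move=> tfN A B f injf; apply: tensor_map_inj => s.
move=> /tensor_rel_swap/tensor_rel_relations[L [LE LP]].
pose V := undup ([seq p.2 | p <- s] ++ flatten [seq [seq p.2 | p <- l] | l <- L]).
have LV l : l \in L -> {subset [seq p.2 | p <- l] <= V}.
  move=> lL e el; rewrite mem_undup mem_cat; apply/orP; right.
  by apply/flattenP; exists [seq p.2 | p <- l] => //; apply: map_f.
have uV : uniq V by apply: undup_uniq.
set n := size V; pose v (j : 'I_n) := nth 0 V j.
pose A0 := relation_mx 0 V L.
have A0v : mxact A0 v = fun=> 0.
  apply/funext => i; rewrite /v (mxact_relation 0 id) //.
  by apply: LE; apply: mem_nth.
have [X [X' [D [U [U' [XX UU AE Dd]]]]]] := chain_diagonalizable chR A0.
pose w := mxact U v.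
have Dw : mxact D w = fun=> 0.
  have DU : D *m U = X' *m A0 by rewrite AE !mulmxA (mulmx1C XX) mul1mx.
  rewrite /w -mxactM DU mxactM A0v.
  by apply/funext => i; rewrite /mxact big1 // => j _; rewrite scaler0.
pose Fr : lmodType R := ('I_n -> R^o)%type.
pose delta (j : 'I_n) : Fr := fun k => (k == j)%:R.
(* In diagonal coordinates each relation is [d *: w j = 0], so [d = 0] or [w j = 0]; in either case
   it holds for [y j] as well. *)
pose y (j : 'I_n) : Fr := if w j == 0 then 0 else delta j.
have [psi psiE] : exists psi : {linear Fr -> N}, forall z, psi z = \sum_k (z k : R) *: w k.
  apply: linear_exists => a z z'; rewrite scaler_sumr -big_split /=.
  by apply: eq_bigr => k _; rewrite scalerDl scalerA.
have psiy j : psi (y j) = w j.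
  rewrite psiE /y; case: eqP => [->|_]; first by rewrite big1 // => k _; rewrite scale0r.
  rewrite (bigD1 j) //= /delta eqxx scale1r big1 ?addr0 // => k kj.
  by rewrite (negPf kj) scale0r.
have Dy : mxact D y = fun=> 0.
  apply/funext => i; have [[j ij ->]|[-> //]] := mxact_diag y i Dd.
  rewrite /y; case: eqP => [_|wj]; first exact: scaler0.
  have [[k ik Dk]|[_]] := mxact_diag w i Dd; last by rewrite leqNgt ij (ltn_ord j).
  have jk : k = j by apply: val_inj; rewrite /= -ik.
  rewrite Dw jk in Dk; have [->|//] := tfN _ _ (esym Dk); exact: scale0r.
(* Back in the original coordinates, [psi] sends [x j] to [v j]. *)
pose x := mxact U' y.
pose phi (e : N) : Fr := if insub (index e V) is Some j then x j else 0.
have phiV (j : 'I_n) : phi (nth 0 V j) = x j.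
  by rewrite /phi index_uniq // valK.
have phiL l : l \in L -> satisfies phi l.
  move=> lL; pose i := index l L; have il : (i < size L)%N by rewrite index_mem.
  rewrite /satisfies -[l](nth_index [::] lL) -/i.
  rewrite -(mxact_relation 0 phi uV LV (Ordinal il)) -/A0.
  rewrite (_ : (fun j => _) = x); last by apply/funext => j; apply: phiV.
  rewrite AE /x -mxactM -!mulmxA UU mulmx1 mxactM Dy /mxact big1 // => j _.
  exact: scaler0.
have psiphi e : e \in V -> psi (phi e) = e.
  move=> eV; have iV : (index e V < n)%N by rewrite index_mem.
  rewrite -{1}(nth_index 0 eV) (phiV (Ordinal iV)) /x /mxact linear_sum.
  transitivity (mxact U' w (Ordinal iV)).
    by apply: eq_bigr => k _; rewrite linearZZ psiy.
  by rewrite /w -mxactM (mulmx1C UU) mxact1 /v nth_index.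
have /tensor_rel_swap := LP _ phi phiL; rewrite -!map_comp /= => h.
have flF : flat Fr.
  have /choice[c cE] : forall i : 'I_n, exists c : {linear Fr -> R^o}, forall z, c z = z i.
    by move=> i; exact: (@linear_exists R Fr R^o (fun z => z i) (fun a z z' => erefl)).
  apply: (@finite_coordinates_flat _ _ n c delta) => z; apply/funext => k.
  transitivity (\sum_i (z i : R) * (k == i)%:R).
    rewrite (bigD1 k) //= eqxx mulr1 big1 ?addr0 // => i ik.
    by rewrite eq_sym (negPf ik) mulr0.
  by rewrite fct_sumE; apply: eq_bigr => i _; rewrite -cE.
have : tensor_rel [seq (p.1, phi p.2) | p <- s] [::].
  apply/tensor_piP/(flF _ _ _ injf); rewrite !pi_tensor_map; apply/tensor_piP.
  by rewrite -map_comp.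
move=> /(tensor_rel_map idfun psi); rewrite -map_comp (_ : map _ s = s) //.
rewrite -[RHS]map_id; apply/eq_in_map => -[a m] /= sm; congr pair; apply: psiphi.
by rewrite mem_undup mem_cat; apply/orP; left; apply/mapP; exists (a, m).
Qed.

End TorsionFree.

(** * The completion of a chain ring *)

Section ChainRingElements.
Variables (R : comNzRingType) (P : ideal R).
Hypotheses (hR : chain_ring R) (hP : maximal_ideal P).

Lemma multiples_submod (S : comPzRingType) (a : S) :
  submod_set (fun x : S^o => exists c : S, x = c * a).
Proof.
split; first by exists 0; rewrite mul0r.
by move=> b _ _ [c ->] [d ->]; exists (b * c + d); rewrite mulrDl -mulrA.
Qed.

Lemma chain_divisibility_total (S : comPzRingType) (hS : chain_ring S) : divisibility_total S.
Proof.
have mS (a : S) := multiples_submod a.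
move=> a b; have [ab|ba] := hS (set_submod (mS a)) (set_submod (mS b)).
  by right; apply/(set_submodP (mS b))/ab/asboolP; exists 1; rewrite mul1r.
by left; apply/(set_submodP (mS a))/ba/asboolP; exists 1; rewrite mul1r.
Qed.

Lemma divisibility_total_chain (S : comPzRingType) (vS : divisibility_total S) : chain_ring S.
Proof.
move=> I J; have [IJ|nIJ] := pselect {subset I <= J}; [by left|right].
move: nIJ => /existsNP[x /not_implyP[Ix nJx]] y Jy.
have [[c ->]|[c xE]] := vS x y; first exact: (rpredZ c).
by case: nJx; rewrite xE; apply: (rpredZ c).
Qed.

Lemma idealM (x y : R) : x \in P -> x * y \in P.
Proof. by move=> Px; rewrite mulrC; apply: (rpredZ y). Qed.

Lemma notin_unit (a : R) : a \notin P -> exists b, a * b = 1.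
Proof.
move=> aP; pose I := set_submod (multiples_submod a).
have aI : a \in I by apply/asboolP; exists 1; rewrite mul1r.
have [IP|PI] := hR I P; first by rewrite IP in aP.
have [I1|nI1] := boolP ((1 : R^o) \in I).
  by have /asboolP[c ->] := I1; exists c; rewrite mulrC.
by rewrite (hP.2 I PI nI1) in aP.
Qed.

Lemma unit_notin (a b : R) : a * b = 1 -> a \notin P.
Proof. by move=> ab; apply/negP => /(@idealM _ b); rewrite ab; apply/negP; case: hP. Qed.

Lemma notin_sub1 (p : R) : p \in P -> 1 - p \notin P.
Proof.
move=> Pp; apply/negP => h; case: hP => /negP[].
by rewrite -(subrK p 1); apply: rpredD.
Qed.

Lemma notin_add (x y : R) : x \notin P -> x - y \in P -> y \notin P.
Proof.
by move=> xP xyP; apply: contraNN xP => Py; rewrite -(subrK y x); exact: (rpredD xyP Py).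
Qed.

Lemma scaled_submod (t : R) : submod_set (scaled_ideal P t : set R^o).
Proof.
split; first by exists 0; [exact: (rpred0 P)|rewrite mulr0].
move=> a _ _ [p Pp ->] [q Pq ->]; exists (a * p + q); first exact: (rpredD (rpredZ a Pp) Pq).
by rewrite mulrDr mulrCA.
Qed.

Lemma scaledN t x : scaled_ideal P t x -> scaled_ideal P t (- x).
Proof. exact: (@submod_setN R R^o _ _ (scaled_submod t)). Qed.

Lemma scaledM t a x : scaled_ideal P t x -> scaled_ideal P t (a * x).
Proof. exact: (@submod_setZ R R^o _ a _ (scaled_submod t)). Qed.

Lemma scaled_mono t u x : scaled_ideal P (t * u) x -> scaled_ideal P t x.
Proof. by move=> [p Pp ->]; exists (p * u); rewrite ?idealM // mulrA mulrAC. Qed.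

Lemma scaled_self t : scaled_ideal P t t -> t = 0.
Proof.
move=> [p Pp tE]; have [b pb] := notin_unit (notin_sub1 Pp).
rewrite -[t]mulr1 -pb mulrA mulrBr mulr1 -tE subrr mul0r //.
Qed.

(** If [t] divides [x] while [x] is outside [t P], the quotient is a unit; otherwise comparability
    gives the claim. *)
Lemma not_scaled t x : ~ scaled_ideal P t x -> exists c, t = x * c.
Proof.
move=> nx; have [[c xE]|[c tE]] := chain_divisibility_total hR t x; last first.
  by exists c; rewrite mulrC.
have [cP|/notin_unit[b cb]] := boolP (c \in P).
  by case: nx; exists c; rewrite // mulrC.
by exists b; rewrite xE mulrAC cb mul1r.
Qed.

(** Hausdorffness of the topology: take [t = x]. *)
Lemma scaled_all x : (forall t, t != 0 -> scaled_ideal P t x) -> x = 0.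
Proof.
by move=> h; apply/eqP; apply: contrapT => /negP x0; apply/(elimN eqP x0)/scaled_self/h.
Qed.

Lemma common_multiple (s t : R) : s != 0 -> t != 0 ->
  exists2 r, r != 0 & (exists u, r = s * u) /\ (exists u, r = t * u).
Proof.
move=> s0 t0; have [[c tE]|[c sE]] := chain_divisibility_total hR s t.
  by exists t => //; split; [exists c; rewrite mulrC|exists 1; rewrite mulr1].
by exists s => //; split; [exists 1; rewrite mulr1|exists c; rewrite mulrC].
Qed.

Definition scaled_set t := set_submod (scaled_submod t).

(** The class of [t] generates the socle of [R / t P], because every [x] outside [t P] divides
    [t]. *)
Lemma scaled_set_fc t : t != 0 -> finitely_cogenerated (quotmod (scaled_set t)).
Proof.
move=> t0; apply: (@cocyclic_finitely_cogenerated _ _ (quot_proj (scaled_set t) (t : R^o))).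
have projN0 (x : R^o) : quot_proj (scaled_set t) x = 0 <-> scaled_ideal P t x.
  rewrite -(linear0 (quot_proj (scaled_set t))); split.
    by move=> /quot_piP/set_submodP; rewrite subr0.
  by move=> h; apply/quot_piP/set_submodP; rewrite subr0.
split.
  by apply: contraNneq t0 => /projN0/scaled_self ->.
move=> y; have [x ->] := quot_projP y => x0.
have [|c tE] := @not_scaled t x; first by move=> /projN0 h; rewrite h eqxx in x0.
exists c; rewrite -(linearZZ (quot_proj (scaled_set t))); congr (quot_proj _ _).
by rewrite [RHS]tE mulrC.
Qed.

Definition scaled_open t (t0 : t != 0) : fc_open R^o := FcOpen (scaled_set_fc t0).

(** If [G] is not [R], choose [t] whose class generates a simple submodule of [R / G]; then
    [G = t P]. *)
Lemma fc_openE (G : fc_open R^o) :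
  (forall x, x \in G) \/ exists2 t : R, t != 0 & forall x, x \in G <-> scaled_ideal P t x.
Proof.
have [all0|/existsNP[x /negP xG]] := pselect (forall x, x \in G); [by left|right].
have projN0 (z : R^o) : quot_proj G z = 0 <-> z \in G.
  rewrite -(linear0 (quot_proj G)); split.
    by move=> /quot_piP; rewrite subr0.
  by move=> h; apply/quot_piP; rewrite subr0.
have [|y] := finitely_cogenerated_socle (fc_openP G).
  by exists (quot_proj G x); apply: contraNneq xG => /projN0.
have [t -> t0 tP] := quot_projP y.
have ntG : t \notin G by apply: contraNN t0 => /projN0/eqP.
exists t => [|z]; first by apply: contraNneq ntG => ->; apply: rpred0.
split=> [Gz|[p Pp ->]].
  (* An element of [G] outside [t P] would divide [t] and put it in [G]. *)
  apply: contrapT => /not_scaled[c tE]; case/negP: ntG.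
  by rewrite tE mulrC; apply: (rpredZ c).
(* Otherwise simplicity makes [b * p * t] congruent to [t] modulo [G]; as [1 - b * p] is a unit, [t]
   would be in [G]. *)
apply: contrapT => ptG; have [|b] := tP p.
  by rewrite -linearZZ; apply/eqP => /projN0 /=; rewrite /GRing.scale /= mulrC.
have -> : b *: (p *: quot_proj G t) = quot_proj G (b *: (p *: t)).
  by rewrite (linearZZ (quot_proj G)) (linearZZ (quot_proj G)).
move=> /quot_piP h; have [c bc] := notin_unit (notin_sub1 (rpredZ b Pp)).
case/negP: ntG; have := rpredZ (- c) h.
suff -> : (- c) *: (b *: (p *: (t : R^o)) - t) = t by [].
rewrite -[LHS]/(- c * (b * (p * t) - t) : R).
by rewrite mulNr -mulrN opprB mulrA -{1}[t]mul1r -mulrBl mulrA [c * _]mulrC bc mul1r.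
Qed.

End ChainRingElements.

(** * Computing with the coordinates of the completion *)

Section Approximation.
Variables (R : comNzRingType) (P : ideal R).
Hypotheses (hR : chain_ring R) (hP : maximal_ideal P).

Local Notation K := (Rtilde R).
Implicit Types (a b : K) (c d s t u x y : R).

(* [x] represents the coordinate of [a] at [t P]; meaningful for [t != 0] only. *)
Definition approx a t x : Prop := forall G : fc_open R^o,
  (forall y, y \in G <-> scaled_ideal P t y) -> fc_coord a G = quot_proj G (x : R^o).

Lemma scaled_openP t (t0 : t != 0) y :
  y \in (scaled_open hR hP t0 : ideal R) <-> scaled_ideal P t y.
Proof.
by split=> [/(set_submodP (scaled_submod P t))|h] //;
  apply/(set_submodP (scaled_submod P t)).
Qed.

Lemma approxI a t (t0 : t != 0) x :
  fc_coord a (scaled_open hR hP t0) = quot_proj _ (x : R^o) -> approx a t x.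
Proof.
move=> ax G GP; apply: (@fc_coordP _ _ a (scaled_open hR hP t0) G) => // y.
by move=> /scaled_openP /GP.
Qed.

Lemma approx_ex a t : t != 0 -> exists x, approx a t x.
Proof.
move=> t0; have [x ax] := quot_projP (fc_coord a (scaled_open hR hP t0)).
by exists x; apply: approxI.
Qed.

Lemma approx_uniq a t x y : t != 0 -> approx a t x -> approx a t y ->
  scaled_ideal P t (x - y).
Proof.
move=> t0 ax ay; apply/(scaled_openP t0)/quot_piP.
have GP := scaled_openP t0.
by rewrite -[LHS](ax _ GP) -[RHS](ay _ GP).
Qed.

Lemma approx_eq a t x y : approx a t x -> scaled_ideal P t (x - y) -> approx a t y.
Proof. by move=> ax xy G GP; rewrite (ax G GP); apply/quot_piP/GP. Qed.

Lemma approx_mono a t u x : t * u != 0 -> approx a (t * u) x -> approx a t x.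
Proof.
move=> tu0 ax G GP; have tuP := scaled_openP tu0.
apply: (@fc_coordP _ _ a (scaled_open hR hP tu0) G) (ax _ tuP) => y.
by move=> /tuP /scaled_mono h; apply/GP/h.
Qed.

Definition rconst x : K := fc_const (x : R^o).

Lemma approx_rconst x t : approx (rconst x) t x.
Proof. by move=> G GP. Qed.

Lemma approxD a b t x y : approx a t x -> approx b t y -> approx (a + b) t (x + y).
Proof.
by move=> ax bx G GP; rewrite fc_addE (ax G GP) (bx G GP) -linearD.
Qed.

Lemma approxN a t x : approx a t x -> approx (- a) t (- x).
Proof. by move=> ax G GP; rewrite fc_oppE (ax G GP) -linearN. Qed.

Lemma approxB a b t x y : approx a t x -> approx b t y -> approx (a - b) t (x - y).
Proof. by move=> ax bx; apply: approxD => //; apply: approxN. Qed.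

Lemma approxM a b t x y : approx a t x -> approx b t y -> approx (a * b) t (x * y).
Proof.
move=> ax bx G GP; rewrite -[LHS]/(quot_mul (fc_coord a G) (fc_coord b G)).
by rewrite (ax G GP) (bx G GP) quot_mulE.
Qed.

Lemma approxZ (r : R) a t x : approx a t x -> approx (r *: a) t (r * x).
Proof. by move=> ax G GP; rewrite fc_scaleE (ax G GP) -linearZZ. Qed.

Lemma approx_ext a b :
  (forall t, t != 0 -> exists2 x, approx a t x & approx b t x) -> a = b.
Proof.
move=> ab; apply: fc_completion_eq => G.
have [GT|[t t0 GP]] := fc_openE hR hP G; last first.
  by have [x ax bx] := ab t t0; rewrite (ax G GP) (bx G GP).
have [x ->] := quot_projP (fc_coord a G); have [y ->] := quot_projP (fc_coord b G).
exact/quot_piP.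
Qed.

(** Coordinates are indexed by open submodules, and one of them may be [t P] for many [t]. One such
    [t] is chosen per submodule; by [comp], another choice gives the same coset. *)
Lemma approx_make (f : R -> R) :
  (forall t u, t * u != 0 -> scaled_ideal P t (f (t * u) - f t)) ->
  exists a, forall t, t != 0 -> approx a t (f t).
Proof.
move=> fP.
pose Q (G : fc_open R^o) t := t != 0 /\ forall x, x \in G <-> scaled_ideal P t x.
have /choice[h hP'] : forall G : fc_open R^o, exists x : R,
    forall t, Q G t -> exists2 s, Q G s & x = f s.
  move=> G; have [[t Qt]|nQ] := pselect (exists t, Q G t).
    by exists (f t) => s _; exists t.
  (* The default 0 is for a [G] that is no [t P], such as [R] itself. *)
  by exists 0 => t Qt; case: nQ; exists t.
have comp s t : s != 0 -> t != 0 ->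
    (forall x, scaled_ideal P t x -> scaled_ideal P s x) -> scaled_ideal P s (f t - f s).
  move=> s0 t0 ts; have [[c tE]|[c sE]] := chain_divisibility_total hR s t.
    by rewrite tE mulrC in t0 *; apply: fP.
  rewrite -opprB; apply/scaledN/ts; rewrite sE mulrC in s0 *; exact: fP.
have coordP (G H : fc_open R^o) (x : R^o) : {subset G <= H} ->
    quot_proj G (h G : R^o) = quot_proj G x -> quot_proj H (h H : R^o) = quot_proj H x.
  move=> GH /quot_piP Gx.
  have [HT|[s s0 HP]] := fc_openE hR hP H; first exact/quot_piP.
  have [GT|[t t0 GP]] := fc_openE hR hP G.
    by case/negP: s0; apply/eqP/(scaled_self hR hP)/HP/GH.
  have [s' [s'0 H'] hH] := hP' H s (conj s0 HP).
  have [t' [t'0 G'] hG] := hP' G t (conj t0 GP).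
  apply/quot_piP; rewrite (_ : _ - x = ((h H : R^o) - h G) + (h G - x)); last first.
    by rewrite addrA subrK.
  apply: rpredD; last exact: GH.
    rewrite hH hG; rewrite -submodN opprB; apply/H'/comp => // y.
    by move=> /G' /GH /H'.
exists (FcCompletion coordP) => t t0 G GP.
have [s [s0 GP'] hG] := hP' G t (conj t0 GP).
rewrite /= hG; apply/quot_piP/GP; apply: comp => // x.
by move=> /GP' /GP.
Qed.

Lemma approx_at_multiple a t u x : t * u != 0 -> approx a t x ->
  exists p, p \in P /\ approx a (t * u) (x + t * p).
Proof.
move=> tu0 ax; have [y ay] := approx_ex a tu0.
have t0 : t != 0 by apply: contraNneq tu0 => ->; rewrite mul0r.
have [p Pp yx] := approx_uniq t0 (approx_mono tu0 ay) ax.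
by exists p; split=> //; rewrite -yx addrC subrK.
Qed.

Lemma rconstD x y : rconst (x + y) = rconst x + rconst y.
Proof.
by apply: approx_ext => t t0; exists (x + y); [|apply: approxD]; apply: approx_rconst.
Qed.

Lemma rconstM x y : rconst (x * y) = rconst x * rconst y.
Proof.
by apply: approx_ext => t t0; exists (x * y); [|apply: approxM]; apply: approx_rconst.
Qed.

Lemma scale_rconst x a : x *: a = rconst x * a.
Proof.
apply: approx_ext => t t0; have [y ay] := approx_ex a t0.
by exists (x * y); [apply: approxZ|apply: approxM => //; apply: approx_rconst].
Qed.

Lemma rconst_inj x y : rconst x = rconst y -> x = y.
Proof.
move=> xy; apply/eqP; rewrite -subr_eq0; apply/eqP/(scaled_all hR hP) => t t0.
have ay : approx (rconst x) t y by rewrite xy; apply: approx_rconst.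
exact: (approx_uniq t0 (@approx_rconst x t) ay).
Qed.

(* A zero divisor annihilating [d] only sees the coordinate at [d P]. *)
Lemma rconst_mul_zero_divisor c d b x : d != 0 -> c * d = 0 -> approx b d x ->
  rconst c * b = rconst (c * x).
Proof.
move=> d0 cd bx; apply: approx_ext => t t0.
have [r r0 [[u rd] [v rt]]] := common_multiple hR d0 t0.
exists (c * x); last exact: approx_rconst.
rewrite rd in r0; have [p [Pp bp]] := approx_at_multiple r0 bx.
have -> : c * x = c * (x + d * p) by rewrite mulrDr mulrA cd mul0r addr0.
apply: approxM; first exact: approx_rconst.
by rewrite -rd rt in r0 bp; apply: approx_mono bp.
Qed.

(** As [c] is regular, the coordinate of the quotient at [t P] is read off that of [a] at [c t P],
    which is still a multiple of [c] because refining moves it only within [c P]. *)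
Lemma rconst_divides c a y : (forall x, c * x = 0 -> x = 0) -> c != 0 ->
  approx a c (c * y) -> exists b, a = rconst c * b.
Proof.
move=> reg c0 ac.
have regM t : t != 0 -> c * t != 0 by apply: contraNneq => /reg ->.
have /choice[f fP] : forall t, exists y, t != 0 -> approx a (c * t) (c * y).
  move=> t; have [->|t0] := eqVneq t 0; first by exists 0.
  have [p [Pp ap]] := approx_at_multiple (regM t t0) ac.
  by exists (y + p); rewrite mulrDr.
have [|b bP] := approx_make (f := f).
  move=> t u tu0; have t0 : t != 0 by apply: contraNneq tu0 => ->; rewrite mul0r.
  have := approx_uniq (regM t t0) _ (fP t t0); have := fP _ tu0.
  rewrite mulrA => h /(_ _ (approx_mono _ h)); rewrite -mulrA => /(_ (regM _ tu0)).
  move=> [p Pp e]; exists p => //; apply/eqP; rewrite -subr_eq0; apply/eqP/reg.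
  by rewrite mulrBr mulrBr e mulrA subrr.
exists b; apply: approx_ext => t t0; exists (c * f t).
  by have h := fP t t0; rewrite mulrC in h; apply: approx_mono h; rewrite mulrC regM.
by apply: approxM; [apply: approx_rconst|apply: bP].
Qed.

(** All coordinates of [a] agree with [x] modulo [P], hence are units; their inverses are compatible
    because [z - z' = z * z' * (y' - y)]. *)
Lemma approx_unit a x : approx a 1 x -> x \notin P -> exists b, a * b = 1.
Proof.
move=> ax xP; have n10 : (1 : R) != 0 by apply: oner_neq0.
have a1 t y : t != 0 -> approx a t y -> y \notin P.
  move=> t0 ay; apply: (notin_add xP).
  rewrite -[t]mul1r in t0 ay; have [p Pp ->] := approx_uniq n10 ax (approx_mono t0 ay).
  by rewrite mul1r.
have /choice[f fP] : forall t, exists z, t != 0 -> exists2 y, approx a t y & y * z = 1.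
  move=> t; have [->|t0] := eqVneq t 0; first by exists 0.
  have [y ay] := approx_ex a t0; have [z yz] := notin_unit hR hP (a1 t y t0 ay).
  by exists z => _; exists y.
have [|b bP] := approx_make (f := f).
  move=> t u tu0; have t0 : t != 0 by apply: contraNneq tu0 => ->; rewrite mul0r.
  have [y ay yz] := fP _ tu0; have [y' ay' yz'] := fP _ t0.
  have -> : f (t * u) - f t = f (t * u) * f t * (y' - y).
    rewrite mulrBr -mulrA [f t * y']mulrC yz' mulr1; congr (_ - _).
    by rewrite mulrAC [_ * y]mulrC yz mul1r.
  by apply: scaledM; apply: (approx_uniq t0 ay'); apply: approx_mono ay.
exists b; apply: approx_ext => t t0; have [y ay yz] := fP t t0.
by exists 1; [rewrite -yz; apply: approxM => //; apply: bP|apply: approx_rconst].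
Qed.

(** The kernel of the residue map from the completion to [R / P]. *)
Definition Ktilde_ideal : set K^o := fun a => forall x, approx a 1 x -> x \in P.

Lemma Ktilde_ideal_submod : submod_set (Ktilde_ideal : set (K^o : lmodType K)).
Proof.
have n10 : (1 : R) != 0 by apply: oner_neq0.
have key a x y : approx a 1 x -> x \in P -> approx a 1 y -> y \in P.
  move=> ax Px ay; have [p Pp yx] := approx_uniq n10 ay ax.
  by rewrite -[y](subrK x) yx mul1r; exact: (rpredD Pp Px).
split; first by move=> x; apply: (key 0 0); [apply: approx_rconst|apply: (rpred0 P)].
move=> a b c Kb Kc z; have [x ax] := approx_ex a n10.
have [y by'] := approx_ex b n10; have [w cw] := approx_ex c n10.
apply: (key _ (x * y + w)); first by apply: approxD cw; apply: approxM.
by apply: (rpredD (rpredZ x (Kb _ by')) (Kc _ cw)).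
Qed.

Lemma Ktilde_unit a : ~ Ktilde_ideal a -> exists b, a * b = 1.
Proof.
by move=> /existsNP[x /not_implyP[ax /negP xP]]; apply: approx_unit xP.
Qed.

Lemma Rtilde_local : local_ring K.
Proof.
pose I : ideal K := set_submod Ktilde_ideal_submod.
have n1I : (1 : K^o) \notin I.
  apply/negP => /(set_submodP Ktilde_ideal_submod)/(_ 1 (@approx_rconst 1 1)) h.
  by case: hP => /negP[].
have sub (J : ideal K) : (1 : K^o) \notin J -> {subset J <= I}.
  move=> J1 a Ja; apply/set_submodP; apply: contrapT => /Ktilde_unit[b ab].
  by case/negP: J1; rewrite -ab mulrC; exact: (rpredZ b Ja).
exists I; split.
  by split=> // J _ J1; apply: sub.
move=> Q [Q1 Qmax] a; apply/idP/idP; first exact: sub.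
exact: (Qmax I (sub Q Q1) n1I).
Qed.

End Approximation.

(** * Factorizations and products in the completion *)

Section RtildeStructure.
Variables (R : comNzRingType) (P : ideal R).
Hypotheses (hR : chain_ring R) (hP : maximal_ideal P).

Local Notation K := (Rtilde R).
Local Notation approx := (@approx R P).
Local Notation rconst := (@rconst R).
Implicit Types (a b : K) (c d r s t u x y : R).

Definition regular c := forall x, c * x = 0 -> x = 0.

Lemma not_regular c : ~ regular c -> exists2 d, d != 0 & c * d = 0.
Proof. by move=> /existsNP[d /not_implyP[cd /eqP d0]]; exists d. Qed.

Lemma regular_neq0 c : regular c -> c != 0.
Proof.
move=> reg; apply/eqP => c0; have := oner_neq0 R.
by rewrite (reg 1) ?eqxx // c0 mul0r.
Qed.

Lemma approx_nonzero a : a != 0 ->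
  exists t x, [/\ t != 0, approx a t x & ~ scaled_ideal P t x].
Proof.
move=> a0; apply: contrapT => nex; move/eqP: a0; apply.
apply: (approx_ext hR hP) => t t0; have [x ax] := approx_ex hR hP a t0.
have [sx|nsx] := pselect (scaled_ideal P t x); last by case: nex; exists t, x.
by exists 0; [apply: approx_eq ax _; rewrite subr0|apply: approx_rconst].
Qed.

(** With [a = c u] and [y] a coordinate of [u], [c - c * y] lies in [c P]; cancelling [c] puts
    [1 - y] in [P], so [u] is a unit. *)
Lemma regular_form a c : regular c -> approx a c c ->
  exists u v : K, a = rconst c * u /\ u * v = 1.
Proof.
move=> reg ac; have c0 := regular_neq0 reg; have n10 : (1 : R) != 0 by apply: oner_neq0.
have [|u au] := rconst_divides hR hP (a := a) (y := 1) reg c0; first by rewrite mulr1.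
have [y uy] := approx_ex hR hP u c0.
have [p Pp e] : scaled_ideal P c (c - c * y).
  by apply: (approx_uniq hR hP c0 ac); rewrite au; apply: approxM => //; apply: approx_rconst.
have yP : y \notin P.
  apply: (notin_add (x := 1)); first by case: hP.
  rewrite (_ : 1 - y = p) //; apply/eqP; rewrite -subr_eq0; apply/eqP/reg.
  by rewrite mulrBr mulrBr mulr1 e subrr.
have [|v uv] := approx_unit hR hP (a := u) (x := y) _ yP; last by exists u, v.
by apply: (approx_mono hR hP (u := c)); rewrite mul1r.
Qed.

Lemma domain_form a : GRing.integral_domain_axiom R -> a != 0 ->
  exists c (u v : K), [/\ c != 0, a = rconst c * u & u * v = 1].
Proof.
move=> dom /approx_nonzero[t [x [t0 ax /(not_scaled hR hP)[c tE]]]].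
have reg : regular x.
  move=> y /dom/orP[/eqP x0|/eqP//]; by rewrite tE x0 mul0r eqxx in t0.
(* Since [x] divides [t], the coordinate of [a] at [x P] is [x] itself, as [regular_form] asks. *)
rewrite tE in t0 ax; have [u [v [au uv]]] := regular_form reg (approx_mono hR hP t0 ax).
by exists x, u, v; split=> //; apply: regular_neq0.
Qed.

Lemma domain_divisibility_total : GRing.integral_domain_axiom R -> divisibility_total K.
Proof.
move=> dom a b; have [->|a0] := eqVneq a 0; first by right; exists 0; rewrite mul0r.
have [->|b0] := eqVneq b 0; first by left; exists 0; rewrite mul0r.
have [c [u [v [_ -> uv]]]] := domain_form dom a0.
have [d [u' [v' [_ -> uv']]]] := domain_form dom b0.
have [[e ->]|[e ->]] := chain_divisibility_total hR c d; [left|right].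
  by exists (rconst e * u' * v); rewrite (rconstM hR hP) mulrACA [v * _]mulrC uv mulr1 mulrAC.
by exists (rconst e * u * v'); rewrite (rconstM hR hP) mulrACA [v' * _]mulrC uv' mulr1 mulrAC.
Qed.

Lemma complete_divisibility_total : fc_complete R^o -> divisibility_total K.
Proof.
move=> comp a b; have [x <-] := comp a; have [y <-] := comp b.
have [[e ->]|[e ->]] := chain_divisibility_total hR (x : R) (y : R); [left|right];
  exists (rconst e); exact: (rconstM hR hP).
Qed.

(** Of two nonzero elements with product 0, one is a multiple of the other and so squares to 0. *)
Lemma square_zero : ~ GRing.integral_domain_axiom R ->
  exists2 r : R, r != 0 & r * r = 0.
Proof.
move=> /existsNP[x /existsNP[y /not_implyP[xy /negP]]]; rewrite negb_or => /andP[x0 y0].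
have [[c yE]|[c xE]] := chain_divisibility_total hR x y.
  by exists y => //; rewrite {1}yE -mulrA xy mulr0.
by exists x => //; rewrite {2}xE mulrCA xy mulr0.
Qed.

(* The two Gaussian conditions on [(a, b)] when it is [a ^+ 2] that generates the
   square of the ideal. *)
Definition square_dominates (S : comPzRingType) (a b : S) : Prop :=
  (exists k l : S, a * b = k * a ^+ 2 /\ b ^+ 2 = l * a ^+ 2) /\ (a * b = 0 -> b ^+ 2 = 0).

Lemma dvd_square_dominates (S : comPzRingType) (a b : S) :
  (exists c : S, b = c * a) -> square_dominates a b.
Proof.
move=> [c ->]; split.
  by exists c, (c ^+ 2); rewrite exprMn !expr2 mulrCA.
by rewrite mulrCA expr2 -mulrA => e; rewrite [a * _]mulrCA e mulr0.
Qed.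

(** If [y] is regular too, [a] and [b] are associated to elements of [R], which are comparable. If
    not, [x] divides [y], and then [a] divides [b]. *)
Lemma regular_square_dominates (r : R) a b x y : r != 0 -> r * r = 0 ->
  approx a r x -> approx b r y -> regular x -> 
  square_dominates a b \/ square_dominates b a.
Proof.
move=> r0 rr ax ay regx.
(* A multiple of [r] kills [r], so a regular [c] is none; hence [c] divides [r], and coordinates at
   [r P] restrict to [c P]. *)
have dvd_r c : regular c -> exists p, r = c * p.
  move=> regc; have [[p ->]|[q cE]] := chain_divisibility_total hR c r.
    by exists p; rewrite mulrC.
  by move: r0; rewrite (regc r) ?eqxx // cE -mulrA rr mulr0.
have form a' x' : approx a' r x' -> regular x' ->
    exists u v : K, a' = rconst x' * u /\ u * v = 1.
  move=> ax' regx'; apply: regular_form => //; have [p rE] := dvd_r _ regx'.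
  by rewrite rE in r0 ax'; apply: approx_mono ax'.
have [u [v [aE uv]]] := form a x ax regx.
have [regy|/not_regular[d d0 yd]] := pselect (regular y).
  have [u' [v' [bE uv']]] := form b y ay regy.
  have [[e yE]|[e xE]] := chain_divisibility_total hR x y; [left|right];
    apply: dvd_square_dominates.
    exists (rconst e * u' * v); rewrite aE bE yE (rconstM hR hP).
    by rewrite mulrACA [v * _]mulrC uv mulr1 mulrAC.
  exists (rconst e * u * v'); rewrite aE bE xE (rconstM hR hP).
  by rewrite mulrACA [v' * _]mulrC uv' mulr1 mulrAC.
left; apply: dvd_square_dominates.
have [e yE] : exists e, y = x * e.
  have [[e ->]|[e xE]] := chain_divisibility_total hR x y; first by exists e; rewrite mulrC.
  by move: d0; rewrite (regx d) ?eqxx // xE -mulrA yd mulr0.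
have [p rE] := dvd_r _ regx.
have bx : approx b x (x * e) by rewrite -yE; rewrite rE in r0 ay; apply: approx_mono ay.
have [b' bE] := rconst_divides hR hP regx (regular_neq0 regx) bx.
exists (b' * v); rewrite bE aE mulrACA [b' * _]mulrC -mulrA; congr (_ * _).
by rewrite [v * u]mulrC uv mulr1.
Qed.

(** Write [a = a' + x] and [b = b' + y] with [a'] and [b'] vanishing at [r P]. Then [a' * b' = 0]
    because [r * r = 0], and the cross terms lie in [R] because [x] and [y] are zero divisors. *)
Lemma zero_divisor_mul (r : R) a b x y : r != 0 -> r * r = 0 ->
  approx a r x -> approx b r y -> ~ regular x -> ~ regular y ->
  exists z, a * b = rconst z.
Proof.
move=> r0 rr ax ay /not_regular[d d0 xd] /not_regular[e e0 ye].
pose a' := a - rconst x; pose b' := b - rconst y.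
have a'r : approx a' r 0 by rewrite -(subrr x); apply: approxB => //; apply: approx_rconst.
have b'r : approx b' r 0 by rewrite -(subrr y); apply: approxB => //; apply: approx_rconst.
have ab' : a' * b' = 0.
  apply: (approx_ext hR hP) => t t0.
  have [s s0 [[u sE] [v sE']]] := common_multiple hR r0 t0.
  rewrite sE in s0; have [p [_ ap]] := approx_at_multiple hR hP s0 a'r.
  have [q [_ bq]] := approx_at_multiple hR hP s0 b'r.
  exists 0; last exact: approx_rconst.
  have := approxM ap bq; rewrite !add0r mulrACA rr mul0r -sE sE' in s0 *.
  exact: approx_mono.
have [w bw] := approx_ex hR hP b' d0; have [z az] := approx_ex hR hP a' e0.
exists (x * y + x * w + y * z).
rewrite !(rconstD hR hP) -(rconst_mul_zero_divisor hR hP d0 xd bw) (rconstM hR hP).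
rewrite -(rconst_mul_zero_divisor hR hP e0 ye az).
have aE : a = a' + rconst x by rewrite subrK.
have bE : b = b' + rconst y by rewrite subrK.
clearbody a' b'.
rewrite [in LHS]aE [in LHS]bE mulrDl !mulrDr ab' add0r addrC [a' * _]mulrC.
by rewrite [_ * b' + _]addrC.
Qed.

(** A coordinate [s] outside [t P] divides [t = s * q], so the finer coordinates [s + t * p] are
    [s * (1 + q * p)], with the second factor a unit. *)
Lemma approx_valuation a : a != 0 -> exists t s, t != 0 /\
  forall w, t * w != 0 -> exists2 u, u \notin P & approx a (t * w) (s * u).
Proof.
move=> /approx_nonzero[t [s [t0 ats /(not_scaled hR hP)[q tE]]]].
exists t, s; split=> // w tw0; have [p [Pp ap]] := approx_at_multiple hR hP tw0 ats.
exists (1 + q * p); last by rewrite mulrDr mulr1 mulrA -tE.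
have := notin_sub1 hP (rpredZ (- q) Pp).
by rewrite -[_ *: _]/(- q * p) mulNr opprK.
Qed.

(** At fine levels [a] and [b] have coordinates [s * u] and [s * q * v] with units [u] and [v]. So
    [x], [y], [z] are arbitrarily close to unit multiples of [s * s], [s * s * q], [s * s * q * q],
    which settles divisibility by [x] and vanishing. *)
Lemma zero_divisor_square_dominates a b x y z t t' s q :
  a * a = rconst x -> a * b = rconst y -> b * b = rconst z -> t != 0 -> t' != 0 ->
  (forall w, t * w != 0 -> exists2 u, u \notin P & approx a (t * w) (s * u)) ->
  (forall w, t' * w != 0 -> exists2 u, u \notin P & approx b (t' * w) (s * q * u)) ->
  square_dominates a b.
Proof.
move=> aaE abE bbE t0 t'0 ha hb.
have small w : w != 0 -> exists2 r, r != 0 & (exists v, r = w * v) /\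
    exists u v, [/\ u \notin P, v \notin P, approx a r (s * u) & approx b r (s * q * v)].
  move=> w0; have [r1 r10 [[e1 r1t] [e2 r1t']]] := common_multiple hR t0 t'0.
  have [r r0 [[e3 rr1] [e4 rw]]] := common_multiple hR r10 w0.
  exists r => //; split; first by exists e4.
  have rt : r = t * (e1 * e3) by rewrite rr1 r1t mulrA.
  have rt' : r = t' * (e2 * e3) by rewrite rr1 r1t' mulrA.
  have [|u uP au] := ha (e1 * e3); first by rewrite -rt.
  have [|v vP bv] := hb (e2 * e3); first by rewrite -rt'.
  by exists u, v; split=> //; rewrite ?rt // -rt rt'.
have Runit u : u \notin P -> exists v, u * v = 1 by apply: notin_unit.
have vanish c : (forall w, w != 0 -> exists2 k, k \notin P & scaled_ideal P w (k * c)) -> c = 0.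
  move=> hc; apply: (scaled_all hR hP) => w w0; have [k kP kc] := hc w w0.
  have [v kv] := Runit k kP.
  by rewrite -[c]mul1r -kv [k * v]mulrC -mulrA; apply: scaledM.
have unitM u v : u \notin P -> v \notin P -> u * v \notin P.
  move=> /Runit[u' uu] /Runit[v' vv]; apply: (unit_notin hP (b := u' * v')).
  by rewrite mulrACA uu vv mulr1.
have estimates w : w != 0 -> exists r u v, [/\ r != 0, exists e, r = w * e,
    u \notin P, v \notin P & [/\ scaled_ideal P r (x - s * s * (u * u)),
    scaled_ideal P r (y - s * s * q * (u * v)) &
    scaled_ideal P r (z - s * s * q * q * (v * v))]].
  move=> /small[r r0 [rw [u [v [uP vP au bv]]]]]; exists r, u, v; split=> //.
  have E a1 a2 x1 x2 y' : approx a1 r x1 -> approx a2 r x2 -> a1 * a2 = rconst y' ->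
      scaled_ideal P r (y' - x1 * x2).
    move=> h1 h2 e; have := approxM h1 h2; rewrite e => h.
    exact: (approx_uniq hR hP r0 (@approx_rconst R P y' r) h).
  split.
  - by have := E _ _ _ _ _ au au aaE; rewrite mulrACA.
  - by have := E _ _ _ _ _ au bv abE; rewrite mulrACA [s * (s * q)]mulrA.
  - have := E _ _ _ _ _ bv bv bbE; rewrite mulrACA (mulrACA s q s q).
    by rewrite [s * s * (q * q)]mulrA.
have mono r w c : (exists e, r = w * e) -> scaled_ideal P r c -> scaled_ideal P w c.
  by move=> [e ->]; apply: scaled_mono.
have ss0 : x = 0 -> s * s = 0.
  move=> x0; apply: vanish => w /estimates[r [u [v [r0 rw uP vP [hx _ _]]]]].
  exists (u * u); first exact: unitM.
  move: hx; rewrite x0 sub0r => /scaledN; rewrite opprK mulrC; exact: mono.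
have const_small c (k : R) : (forall w, w != 0 -> exists m, scaled_ideal P w (c - k * m)) ->
    k = 0 -> c = 0.
  move=> hc k0; apply: (scaled_all hR hP) => w /hc[m].
  by rewrite k0 mul0r subr0.
have yq : s * s * q = 0 -> y = 0.
  apply: const_small => w /estimates[r [u [v [_ rw _ _ [_ hy _]]]]].
  by exists (u * v); apply: mono hy.
have zq : s * s * q = 0 -> z = 0.
  apply: const_small => w /estimates[r [u [v [_ rw _ _ [_ _ hz]]]]].
  by exists (q * (v * v)); rewrite [s * s * q * _]mulrA; apply: mono hz.
split; last first.
  rewrite abE => y0; rewrite expr2 bbE zq //; apply: vanish => w.
  move=> /estimates[r [u [v [r0 rw uP vP [_ hy _]]]]].
  exists (u * v); first exact: unitM.
  move: hy; rewrite (rconst_inj hR hP y0) sub0r => /scaledN; rewrite opprK mulrC; exact: mono.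
(* If [x = 0], then [s * s = 0] and everything vanishes; otherwise the estimate modulo [x P] makes
   [s * s] a multiple of [x]. *)
rewrite !expr2 aaE abE bbE; have [x0|x0] := eqVneq x 0.
  have sq0 : s * s * q = 0 by rewrite ss0 ?mul0r.
  by exists 0, 0; rewrite yq // zq // !mul0r.
have [r [u [v [r0 rw uP vP [hx hy hz]]]]] := estimates x x0.
have [k sk] : exists k, s * s = x * k.
  have [p Pp xp] := mono _ _ _ rw hx; have [u' uu] := Runit _ uP.
  exists ((1 - p) * (u' * u')).
  have -> : x * ((1 - p) * (u' * u')) = (x - x * p) * (u' * u').
    rewrite [LHS]mulrA. by rewrite mulrBr mulr1.
  rewrite -xp opprB addrC subrK -[s * s * (u * u) * _]mulrA.
  by rewrite [u * u * (u' * u')]mulrACA uu !mulr1.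
have dvdx c m : scaled_ideal P r (c - s * s * m) -> exists l, c = l * x.
  move=> /(mono _ _ _ rw)[p Pp e]; exists (p + k * m).
  by rewrite mulrDl [p * x]mulrC -e [k * m * x]mulrC mulrA -sk subrK.
have [l lE] : exists l, y = l * x.
  by apply: (dvdx _ (q * (u * v))); rewrite mulrA.
have [l' lE'] : exists l, z = l * x.
  by apply: (dvdx _ (q * q * (v * v))); rewrite !mulrA in hz *.
by exists (rconst l), (rconst l'); rewrite lE lE' !(rconstM hR hP).
Qed.

Lemma Rtilde_square_dominates a b : square_dominates a b \/ square_dominates b a.
Proof.
have [/domain_divisibility_total/(_ a b)[h|h]|/square_zero[r r0 rr]] :=
  pselect (GRing.integral_domain_axiom R).
- by left; apply: dvd_square_dominates.
- by right; apply: dvd_square_dominates.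
have [x ax] := approx_ex hR hP a r0; have [y by'] := approx_ex hR hP b r0.
have [rx|nx] := pselect (regular x); first exact: (regular_square_dominates r0 rr ax by').
have [ry|ny] := pselect (regular y).
  by have [|] := regular_square_dominates r0 rr by' ax ry; [right|left].
have [->|a0] := eqVneq a 0.
  by right; apply: dvd_square_dominates; exists 0; rewrite mul0r.
have [->|b0] := eqVneq b 0.
  by left; apply: dvd_square_dominates; exists 0; rewrite mul0r.
have [aa aaE] := zero_divisor_mul r0 rr ax ax nx nx.
have [ab abE] := zero_divisor_mul r0 rr ax by' nx ny.
have [bb bbE] := zero_divisor_mul r0 rr by' by' ny ny.
have [t [s [t0 ha]]] := approx_valuation a0.
have [t' [s' [t'0 hb]]] := approx_valuation b0.
have [[q sE]|[q sE]] := chain_divisibility_total hR s s'; [left|right].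
  apply: (@zero_divisor_square_dominates a b aa ab bb t t' s q) => //.
  by move=> w /hb[u uP bu]; exists u; rewrite // [s * q]mulrC -sE.
apply: (@zero_divisor_square_dominates b a bb ab aa t' t s' q) => //; first by rewrite mulrC.
by move=> w /ha[u uP bu]; exists u; rewrite // [s' * q]mulrC -sE.
Qed.

End RtildeStructure.

(** * From the square conditions to the Gaussian property *)

Section Gaussian.
Variable S : comPzRingType.

Lemma generated_sub (M : lmodType S) (X : set M) x : X x -> x \in generated X.
Proof. by move=> Xx; apply/asboolP => N; apply. Qed.

Lemma generated_ind (M : lmodType S) (X Y : set M) : submod_set Y ->
  (X `<=` Y)%classic -> forall x, x \in generated X -> Y x.
Proof.
move=> sY XY x /asboolP/(_ (set_submod sY)) h; apply/(set_submodP sY)/h => y Xy.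
exact/set_submodP/XY.
Qed.

Lemma generated_pair (a b x : S^o) : x \in generated [set a; b] ->
  exists u v : S, x = u * a + v * b.
Proof.
apply: (@generated_ind S^o _ (fun x : S^o => exists u v : S, x = u * a + v * b)).
  split; first by exists 0, 0; rewrite !mul0r addr0.
  move=> r _ _ [u [v ->]] [u' [v' ->]]; exists (r * u + u'), (r * v + v').
  by rewrite -[r *: _]/(r * _) mulrDr !mulrDl !mulrA addrACA.
move=> y [->|->]; first by exists 1, 0; rewrite mul1r mul0r addr0.
by exists 0, 1; rewrite mul1r mul0r add0r.
Qed.

Lemma multiple_in_generated (M : lmodType S) (X : set M) (m : S) x :
  X x -> m *: x \in generated X.
Proof. by move=> Xx; rewrite rpredZ // generated_sub. Qed.

Lemma square_dominates_generated (a b : S^o) : square_dominates (a : S) b ->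
  ideal_square (generated [set a; b]) =i generated [set (a : S) ^+ 2 : S^o].
Proof.
move=> [[k [l [abE bbE]]] _].
have ga : a \in generated [set a; b] by apply: generated_sub; left.
move=> x; apply/idP/idP; last first.
  apply: (@generated_ind S^o _ (fun y => y \in generated _)); first exact: submod_closed_set.
  by move=> _ ->; apply: generated_sub; exists a, a; rewrite expr2.
apply: (@generated_ind S^o _ (fun y => y \in generated _)); first exact: submod_closed_set.
move=> _ [y [z [/generated_pair[u [v ->]] /generated_pair[u' [v' ->]] ->]]] /=.
rewrite (_ : (u * a + v * b) * (u' * a + v' * b) =
    (u * u' + (u * v' + v * u') * k + v * v' * l) *: ((a : S) ^+ 2 : S^o)).
  exact: multiple_in_generated.
rewrite [RHS](mulrDl _ _ ((a : S) ^+ 2)) (mulrDl _ _ ((a : S) ^+ 2)) -!mulrA -bbE -abE !expr2.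
rewrite !mulrA -![_ * a * a]mulrA -![_ * a * b]mulrA -![_ * b * b]mulrA.
rewrite mulrDl !mulrDr !(mulrACA _ a) !(mulrACA _ b) [b * a]mulrC.
by rewrite (mulrDl _ _ (a * b)) !addrA.
Qed.

Lemma square_dominates_gaussian :
  local_ring S -> (forall a b : S, square_dominates a b \/ square_dominates b a) ->
  gaussian_local_ring S.
Proof.
move=> locS dom; split=> // a b /=.
have swap (x : S^o) : ideal_square (generated [set a; b]) x =
    ideal_square (generated [set b; a]) x.
  by rewrite (_ : [set a; b] = [set b; a])%classic // setUC.
have [ab|ba] := dom a b.
  by split; [left; apply: square_dominates_generated|move=> _; apply: ab.2].
split; first by right=> x; rewrite -(square_dominates_generated ba); apply: swap.
(* Here [b ^+ 2] dominates: [a * b = 0] forces [a ^+ 2 = 0], so the square of the ideal, which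
   contains [b ^+ 2], is zero. *)
move=> A2 ab0; have a0 : (a : S) ^+ 2 = 0 by apply: ba.2; rewrite mulrC.
have : (b : S) ^+ 2 \in ideal_square (generated [set a; b]).
  apply: generated_sub; exists b, b; rewrite expr2; split=> //; apply: generated_sub; by right.
rewrite A2 a0; apply: (@generated_ind S^o _ [set 0]).
  by split=> // r x y -> ->; rewrite scaler0 addr0.
by move=> x ->.
Qed.

End Gaussian.

(** * Divisibility and flatness of the completion *)

Section RtildeConditions.
Variables (R : comNzRingType) (P : ideal R).
Hypotheses (hR : chain_ring R) (hP : maximal_ideal P).

Local Notation K := (Rtilde R).
Local Notation approx := (@approx R P).
Local Notation rconst := (@rconst R).
Implicit Types (a b : K) (c d r s t u x y : R).

Lemma chain_complete_or_domain : divisibility_total K ->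
  fc_complete R^o \/ GRing.integral_domain_axiom R.
Proof.
move=> vK; have [dom|/(square_zero hR)[r r0 rr]] := pselect (GRing.integral_domain_axiom R).
  by right.
left=> a; have [x ax] := approx_ex hR hP (a : K) r0; pose a' : K := a - rconst x.
have a'r : approx a' r 0 by rewrite -(subrr x); apply: approxB => //; apply: approx_rconst.
have [[b rE]|[b aE]] := vK a' (rconst r).
  (* A multiple of [a'] has coordinate 0 at [r P], which [r] has not. *)
  have [y by'] := approx_ex hR hP b r0.
  have h := approxM by' a'r; rewrite -rE mulr0 in h.
  have := approx_uniq hR hP r0 (@approx_rconst R P r r) h.
  by rewrite subr0 => /(scaled_self hR hP) e; rewrite e eqxx in r0.
(* Now [a'] is a multiple of [r], and such multiples lie in [R] because [r] is a zero divisor. *)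
have [y by'] := approx_ex hR hP b r0.
exists (r * y + x); rewrite -[LHS]/(rconst _) (rconstD hR hP).
by rewrite -(rconst_mul_zero_divisor hR hP r0 rr by') mulrC -aE subrK.
Qed.

Lemma flat_complete_or_domain : flat K ->
  fc_complete R^o \/ GRing.integral_domain_axiom R.
Proof.
move=> fK; have [dom|/(square_zero hR)[r r0 rr]] := pselect (GRing.integral_domain_axiom R).
  by right.
left=> a; have [x ax] := approx_ex hR hP (a : K) r0; pose a' : K := a - rconst x.
have a'r : approx a' r 0 by rewrite -(subrr x); apply: approxB => //; apply: approx_rconst.
suff [z a'E] : exists z, a' = rconst z.
  by exists (z + x); rewrite -[LHS]/(rconst _) (rconstD hR hP) -a'E subrK.
(* [W] is the image of [R]; it contains [(0 : r)] times the completion, whose factors in [(0 : r)]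
   are zero divisors. *)
apply: (@flat_torsion R K r a' (fun a' => exists z, a' = rconst z)) => //.
- split; first by exists 0.
  move=> c _ _ [y ->] [z ->]; exists (c * y + z).
  by rewrite (scale_rconst hR hP) (rconstD hR hP) (rconstM hR hP).
- move=> c b rc0; have [y by'] := approx_ex hR hP b r0.
  exists (c * y); rewrite (scale_rconst hR hP).
  by apply: (rconst_mul_zero_divisor hR hP r0 _ by'); rewrite mulrC.
by rewrite (scale_rconst hR hP) (rconst_mul_zero_divisor hR hP r0 rr a'r) mulr0.
Qed.

Lemma complete_flat : fc_complete R^o -> flat K.
Proof.
move=> comp; have /choice[f fE] : forall a : K, exists x : R^o, rconst x = a by apply: comp.
have [c cE] : exists c : {linear K -> R^o}, forall a, c a = f a.
  apply: linear_exists => r a b; apply: (rconst_inj hR hP).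
  rewrite fE (rconstD hR hP) (rconstM hR hP) !fE.
  by rewrite (scale_rconst hR hP).
apply: (@finite_coordinates_flat R K 1 (fun=> c) (fun=> 1)) => a.
by rewrite big_ord1 cE (scale_rconst hR hP) mulr1 fE.
Qed.

Lemma domain_flat : GRing.integral_domain_axiom R -> flat K.
Proof.
move=> dom; apply: (torsion_free_flat (chain_divisibility_total hR)) => r a ra.
have [->|r0] := eqVneq r 0; [by left|right].
apply: (approx_ext hR hP) => t t0.
(* Cancelling [r] from a congruence modulo [t r P] leaves one modulo [t P], so coordinates are taken
   at [t r P]. *)
have tr0 : t * r != 0.
  by apply/eqP => /dom/orP[] e; [rewrite e in t0|rewrite e in r0].
have [x ax] := approx_ex hR hP a tr0; exists x; first exact: (approx_mono hR hP tr0 ax).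
have h := approxZ r ax; rewrite ra in h.
have [p Pp e] := approx_uniq hR hP tr0 h (@approx_rconst R P 0 _).
apply: (approx_eq (@approx_rconst R P 0 t)); rewrite sub0r; apply: scaledN.
exists p => //; apply/eqP; rewrite -subr_eq0.
have /dom : r * (x - t * p) = 0.
  by rewrite mulrBr -[X in X - _]subr0 e mulrA [t * r]mulrC subrr.
by rewrite (negPf r0).
Qed.

End RtildeConditions.

(** * The completion in the pure-injective hull *)

Section PureInjectiveHull.
Variables (R : comNzRingType) (P : ideal R).
Hypotheses (hR : chain_ring R) (hP : maximal_ideal P).
Variables (Rhat : lmodType R) (iota : {linear R^o -> Rhat}).
Hypothesis hull : pure_injective_hull iota.

Local Notation K := (Rtilde R).
Local Notation approx := (@approx R P).
Local Notation rconst := (@rconst R).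
Implicit Types (a b : K) (c d r s t u x : R) (y z : Rhat).

Lemma iota_inj : injective iota.
Proof. by case: hull. Qed.

Lemma iota_divisible s x y : iota (x : R^o) = s *: y -> exists x', x = s * x'.
Proof.
case: hull => injI pI _ _ xy.
have Fx : iota x \in linear_range iota by apply/asboolP; exists x.
have [_ /asboolP[x' <-]] := pure_relatively_divisible pI Fx (ex_intro _ y xy).
by rewrite -linearZZ => /injI e; exists x'.
Qed.

(** Contrapositive of pure-essentiality, with purity of the image of [R] in [Rhat / L] expressed by
    divisibility. *)
Lemma pure_essential_trivial (L : set Rhat) : submod_set L ->
  (forall x, L (iota (x : R^o)) -> x = 0) ->
  (forall s x y, L (iota (x : R^o) - s *: y) -> exists x', x = s * x') ->
  forall y, L y -> y = 0.
Proof.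
move=> sL Liota Ldiv y Ly; apply/eqP; apply: contrapT => /negP y0.
case: hull => _ _ _ /(_ (set_submod sL)) h.
have [|[z /set_submodP Lz [z0 /asboolP[x xz]]]|np] := h.
- by exists y => //; apply/set_submodP.
- by move/eqP: z0; apply; rewrite -xz (Liota x) ?linear0 // xz.
apply: np; apply: (relatively_divisible_pure (chain_divisibility_total hR)).
move=> s _ /asboolP[x <-] [w].
have [v ->] := quot_projP w => e.
have [|x' xE] := Ldiv s x v.
  by apply/(set_submodP sL)/quot_piP; rewrite -[RHS]/(quot_proj _ (s *: v)) linearZZ -e.
exists ((quot_proj (set_submod sL) \o iota) x'); first by apply/asboolP; exists x'.
by rewrite xE -linearZZ.
Qed.

(** Sums collapse to one term, since of two elements of [P] one divides the other. *)
Lemma scaled_ideal_mulP t y : y \in scaled_ideal_mul P t ->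
  exists p z, p \in P /\ y = (t * p) *: z.
Proof.
apply: (@generated_ind R Rhat _ (fun y => exists p z, p \in P /\ y = (t * p) *: z)).
  split; first by exists 0, 0; rewrite rpred0 scaler0.
  move=> c _ _ [p [z [Pp ->]]] [q [w [Pq ->]]].
  have [[e ->]|[e ->]] := chain_divisibility_total hR p q.
    exists p, (c *: z + e *: w); split=> //.
    by rewrite scalerDr !scalerA [c * _]mulrC [e * p]mulrC mulrA.
  exists q, ((c * e) *: z + w); split=> //.
  by rewrite scalerDr !scalerA; congr (_ *: _ + _);
    rewrite -mulrA mulrC [e * q]mulrC -!mulrA [e * c]mulrC.
by move=> _ [x [p Pp ->] [z ->]]; exists p, z.
Qed.

Lemma scaled_ideal_mulI t p z : p \in P -> (t * p) *: z \in scaled_ideal_mul P t.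
Proof. by move=> Pp; apply: generated_sub; exists (t * p); [exists p|exists z]. Qed.

Lemma iota_scaled t x :
  iota (x : R^o) \in scaled_ideal_mul P t -> scaled_ideal P t x.
Proof.
move=> /scaled_ideal_mulP[p [z [Pp /iota_divisible[x' ->]]]].
by exists (p * x'); rewrite ?mulrA //; apply: idealM.
Qed.

Lemma in_all_cosetsP a y : in_all_cosets P iota a y <->
  forall t x, t != 0 -> approx a t x ->
    y - iota (x : R^o) \in scaled_ideal_mul P t.
Proof.
split=> [ay t x t0 ax|h r G s r0 GP aG].
  exact: (ay t (scaled_open hR hP t0) x t0 (scaled_openP hR hP t0)
    (ax _ (scaled_openP hR hP t0))).
apply: h => // H HP.
by apply: (fc_coordP _ aG) => u /GP /HP.
Qed.

Lemma in_all_cosets_rconst x : in_all_cosets P iota (rconst x) (iota (x : R^o)).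
Proof.
apply/in_all_cosetsP => t x' t0 ax; rewrite -linearB; apply: scaled_ideal_iota.
exact: (approx_uniq hR hP t0 (@approx_rconst R P x t) ax).
Qed.

Lemma in_all_cosets_iota a x : in_all_cosets P iota a (iota (x : R^o)) -> a = rconst x.
Proof.
move=> /in_all_cosetsP ax; apply: (approx_ext hR hP) => t t0.
have [x' ax'] := approx_ex hR hP a t0; exists x'; first by [].
apply: (approx_eq (@approx_rconst R P x t)); apply: iota_scaled.
by rewrite linearB; apply: ax.
Qed.

Section NotCogenerated.
Hypothesis nfc : ~ finitely_cogenerated R^o.

(** If [r P] were 0, then [r] would lie in every nonzero ideal, making [R] cocyclic. *)
Lemma socle_zero r : r != 0 -> exists2 p, p \in P & r * p != 0.
Proof.
move=> r0; apply: contrapT => nex; apply: nfc.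
have rP p : p \in P -> r * p = 0.
  by move=> Pp; apply/eqP; apply: contrapT => /negP rp; apply: nex; exists p.
apply: (@cocyclic_finitely_cogenerated R R^o r); split=> // x x0.
have [[c ->]|[c rE]] := chain_divisibility_total hR (x : R) r; first by exists c.
have [Pc|/(notin_unit hR hP)[d cd]] := boolP ((c : R^o) \in P).
  by rewrite rE mulrC rP ?eqxx in x0.
by exists d; rewrite rE -[LHS]/(d * (c * r)) mulrA [d * c]mulrC cd mul1r.
Qed.

(* The intersection of the [t Rhat] is zero, by pure-essentiality. *)
Lemma in_all_cosets_uniq a y z :
  in_all_cosets P iota a y -> in_all_cosets P iota a z -> y = z.
Proof.
move=> /in_all_cosetsP ay /in_all_cosetsP az.
pose L (y : Rhat) := forall t, t != 0 -> exists w, y = t *: w.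
have sL : submod_set L.
  split; first by move=> t _; exists 0; rewrite scaler0.
  move=> r u v Lu Lv t t0; have [w ->] := Lu t t0; have [w' ->] := Lv t t0.
  by exists (r *: w + w'); rewrite scalerDr !scalerA mulrC.
apply/eqP; rewrite -subr_eq0; apply/eqP; apply: (pure_essential_trivial sL).
- move=> x Lx; apply: (scaled_all hR hP) => t t0.
  (* Divisibility by [t * p], rather than by [t], gives membership in [t P]. *)
  have [p Pp tp0] := socle_zero t0; have [w /iota_divisible[x' ->]] := Lx _ tp0.
  by exists (p * x'); rewrite ?mulrA //; apply: idealM.
- move=> s x w Lx; have [s0|s0] := eqVneq s 0.
    exists 0; rewrite mulr0; apply: (scaled_all hR hP) => t t0.
    have [p Pp tp0] := socle_zero t0; have [v e] := Lx _ tp0.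
    rewrite s0 scale0r subr0 in e; have [x' ->] := iota_divisible e.
    by exists (p * x'); rewrite ?mulrA //; apply: idealM.
  have [v e] := Lx s s0; apply: (@iota_divisible s x (v + w)).
  by rewrite scalerDr -e subrK.
move=> t t0; have [x ax] := approx_ex hR hP a t0.
have /scaled_ideal_mulP[p [w [_ yw]]] := ay t x t0 ax.
have /scaled_ideal_mulP[q [w' [_ zw]]] := az t x t0 ax.
exists (p *: w - q *: w'); rewrite scalerBr !scalerA -yw -zw.
by rewrite opprB addrA subrK.
Qed.

(** The torsion elements form a submodule meeting [R] in 0, modulo which [R] stays relatively
    divisible; pure-essentiality makes it zero. *)
Lemma domain_hull_torsion_free r y : GRing.integral_domain_axiom R ->
  r != 0 -> r *: y = 0 -> y = 0.
Proof.
move=> dom r0 ry0.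
have regM s t : s != 0 -> t != 0 -> s * t != 0.
  by move=> s0 t0; apply/eqP => /dom/orP[] e; [rewrite e in s0|rewrite e in t0].
pose L (y : Rhat) := exists2 t, t != 0 & t *: y = 0.
have sL : submod_set L.
  split; first by exists r; rewrite ?scaler0.
  move=> c u v [s s0 su] [t t0 tv]; exists (s * t); first exact: regM.
  have stu : (s * t) *: u = 0 by rewrite mulrC -scalerA su scaler0.
  have stv : (s * t) *: v = 0 by rewrite -scalerA tv scaler0.
  by rewrite scalerDr stv addr0 scalerA mulrC -scalerA stu scaler0.
apply: (pure_essential_trivial sL); last by exists r.
- move=> x [t t0]; rewrite -linearZZ -(linear0 iota) => /iota_inj.
  by move=> /dom/orP[e|/eqP//]; rewrite e in t0.
move=> s x v [t t0]; rewrite scalerBr scalerA -linearZZ => /eqP.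
rewrite subr_eq0 => /eqP/iota_divisible[x'] e; exists x'; apply/eqP; rewrite -subr_eq0.
have /dom : t * (x - s * x') = 0.
  by rewrite mulrBr mulrA -e subrr.
by rewrite (negPf t0).
Qed.

(* [R] is pure in the module of germs at [0] of functions [R -> R], where the
   coordinates of [a] define a limit of [a]; pure-injectivity maps it to [Rhat]. *)
Lemma limit_exists a : exists y, in_all_cosets P iota a y.
Proof.
pose B : lmodType R := (R -> R^o)%type.
(* The neighbourhoods of 0 are the sets of nonzero multiples of some [t], where coordinates are
   finer than at [t]. *)
pose N (f : B) := exists2 t : R, t != 0 & forall u : R, t * u != 0 -> f (t * u) = 0.
have sN : submod_set N.
  split; first by exists 1; rewrite ?oner_neq0.
  move=> c f g [s s0 fs] [t t0 gt].
  have [r r0 [[u ru] [v rv]]] := common_multiple hR s0 t0.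
  exists r => // w rw0; rewrite -[LHS]/(c *: f (r * w) + g (r * w)).
  rewrite {1}ru -mulrA fs; last by rewrite mulrA -ru.
  by rewrite rv -mulrA gt ?scaler0 ?addr0 // mulrA -rv.
pose pr := quot_proj (set_submod sN).
have prE (f g : B) : N (f - g) -> pr f = pr g.
  by move=> Nfg; apply/quot_piP/set_submodP.
have prN (f g : B) : pr f = pr g -> N (f - g).
  by move=> /quot_piP/set_submodP.
have [diag diagE] : exists diag : {linear R^o -> quotmod (set_submod sN)},
    forall x, diag x = pr (fun=> x).
  by apply: linear_exists => c x x'; rewrite -linearP.
have diag_div s x (g : B) : diag x = s *: pr g -> exists t, x = s * g t.
  rewrite diagE -linearZZ => /prN[t t0 /(_ 1)]; rewrite mulr1 => /(_ t0) e.
  by exists t; apply/eqP; rewrite -subr_eq0; apply/eqP.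
have diag_inj : injective diag.
  move=> x x' e; apply/eqP; rewrite -subr_eq0; apply/eqP.
  have := diag_div 0 (x - x') 0; rewrite linearB e subrr scale0r => /(_ erefl)[t ->].
  by rewrite mul0r.
have pureA : pure_submodule (linear_range diag).
  apply: (relatively_divisible_pure (chain_divisibility_total hR)) => s _ /asboolP[x <-] [w].
  have [g ->] := quot_projP w => /diag_div[t ->].
  by exists (diag (g t)); [apply/asboolP; exists (g t)|rewrite -linearZZ].
(* Inverting [diag] on its range moves [iota] to a pure submodule of the germs, from which it
   extends. *)
have /choice[h hE] : forall w : submod (linear_range diag), exists x, diag x = val w.
  by move=> w; have /asboolP := valP w.
have [f fE] : exists f : {linear submod (linear_range diag) -> Rhat},
    forall w, f w = iota (h w).
  apply: linear_exists => c w w'; rewrite -linearP; congr (iota _); apply: diag_inj.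
  by rewrite linearP !hE.
case: hull => _ _ pinj _; have [g gE] := pinj _ _ f pureA.
have gdiag x : g (diag x) = iota x.
  have Dx : diag x \in linear_range diag by apply/asboolP; exists x.
  rewrite -[diag x]/(submod_incl (linear_range diag) (Submod Dx)) gE fE.
  by congr (iota _); apply: diag_inj; rewrite hE.
have /choice[al alP] : forall t, exists x, t != 0 -> approx a t x.
  move=> t; have [->|t0] := eqVneq t 0; first by exists 0.
  by have [x ax] := approx_ex hR hP a t0; exists x.
exists (g (pr al)); apply/in_all_cosetsP => t x t0 ax.
(* The factor [p] makes multiples of [t'] fall into [t P Rhat]. *)
have [p Pp tp0] := socle_zero t0; set t' := t * p in tp0.
(* Near 0, the germ of the coordinates is the constant [al t'] plus [t'] times the germ of [k]. *)
have /choice[k kP] : forall u : R, exists q : R,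
    (exists2 v : R, u = t' * v & u != 0) -> al u - al t' = t' * q.
  move=> u; have [[v uE u0]|nu] := pselect (exists2 v : R, u = t' * v & u != 0).
    have := alP u u0; rewrite uE in u0 *; move=> /(approx_mono hR hP u0) h1.
    by have [q _ e] := approx_uniq hR hP tp0 h1 (alP _ tp0); exists q.
  by exists 0 => /nu.
have e : g (pr al) - iota (al t') = t' *: g (pr k).
  rewrite -gdiag diagE -linearB -linearZZ; congr (g _); rewrite -linearB -linearZZ.
  apply: prE; exists t' => // v tv0.
  rewrite -[LHS]/(al (t' * v) - al t' - t' * k (t' * v)) kP ?subrr //.
  by exists v.
have -> : g (pr al) - iota x = t' *: g (pr k) + iota ((al t' : R^o) - x).
  by rewrite -e (linearB iota) addrA subrK.
rewrite rpredD ?scaled_ideal_mulI //; apply: scaled_ideal_iota.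
exact: (approx_uniq hR hP t0 (approx_mono hR hP tp0 (alP _ tp0)) ax).
Qed.

Lemma in_hullP y : y \in Rtilde_in_hull P iota <-> exists a, in_all_cosets P iota a y.
Proof.
split=> [/asboolP[[/nfc//]|[_ //]]|h].
by apply/asboolP; right.
Qed.

Lemma hull_pure : fc_complete R^o \/ GRing.integral_domain_axiom R ->
  pure_submodule (Rtilde_in_hull P iota).
Proof.
move=> cd; apply: (relatively_divisible_pure (chain_divisibility_total hR)) => s y.
move=> /in_hullP[a ay] [z yz]; case: cd => [comp|dom].
  have [x xE] := comp a; have yx : y = iota x.
    by apply: (in_all_cosets_uniq ay); rewrite -xE; apply: in_all_cosets_rconst.
  have [x' x'E] : exists x', x = s * x' by apply: (@iota_divisible s x z); rewrite -yx.
  exists (iota x'); last by rewrite -linearZZ yx x'E.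
  by apply/in_hullP; exists (rconst x'); apply: in_all_cosets_rconst.
have [s0|s0] := eqVneq s 0.
  by exists 0; [apply: rpred0|rewrite scaler0 yz s0 scale0r].
exists z => //; apply/in_hullP.
have regs x : s * x = 0 -> x = 0 by move=> /dom/orP[e|/eqP//]; rewrite e in s0.
move/in_all_cosetsP: ay => ay; have [x ax] := approx_ex hR hP a s0.
(* As [y = s *: z], the coordinate of [a] at [s P] is divisible by [s], and hence so is [a]. *)
have [x' xE] : exists x', x = s * x'.
  have /scaled_ideal_mulP[p [w [_ e]]] := ay s x s0 ax.
  apply: (@iota_divisible s x (z - p *: w)).
  by rewrite scalerBr -yz scalerA -e subKr.
rewrite xE in ax; have [b aE] := rconst_divides hR hP regs s0 ax.
(* The quotient [b] has limit [z]: the congruences for [s *: z] at [s t P] are divided by [s], the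
   hull being torsion-free. *)
exists b; apply/in_all_cosetsP => t v t0 bv.
have [w aw] : exists w, approx b (s * t) w.
  by apply: (approx_ex hR hP); apply: contraNneq t0 => /regs ->.
have st0 : s * t != 0 by apply: contraNneq t0 => /regs ->.
have asw : approx a (s * t) (s * w) by rewrite aE; apply: approxM => //; apply: approx_rconst.
have /scaled_ideal_mulP[p [q [Pp e]]] := ay _ _ st0 asw.
have zw : z - iota (w : R^o) = (t * p) *: q.
  apply/eqP; rewrite -subr_eq0; apply/eqP; apply: (domain_hull_torsion_free dom s0).
  by rewrite scalerBr scalerBr -yz -linearZZ e scalerA mulrA subrr.
have -> : z - iota (v : R^o) = (t * p) *: q + iota ((w : R^o) - v).
  by rewrite -zw (linearB iota) addrA subrK.
rewrite rpredD ?scaled_ideal_mulI //; apply: scaled_ideal_iota.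
rewrite mulrC in aw st0; exact: (approx_uniq hR hP t0 (approx_mono hR hP st0 aw) bv).
Qed.

Lemma pure_complete_or_domain : pure_submodule (Rtilde_in_hull P iota) ->
  fc_complete R^o \/ GRing.integral_domain_axiom R.
Proof.
move=> /pure_relatively_divisible rd.
have [dom|/(square_zero hR)[r r0 rr]] := pselect (GRing.integral_domain_axiom R).
  by right.
left=> a; have [y ay] := limit_exists (a : K); have [x ax] := approx_ex hR hP (a : K) r0.
have hy : y - iota (x : R^o) \in Rtilde_in_hull P iota.
  have iH : iota (x : R^o) \in Rtilde_in_hull P iota.
    by apply/in_hullP; exists (rconst x); apply: in_all_cosets_rconst.
  by rewrite rpredD ?submodN //; apply/in_hullP; exists a.
(* [y - iota x] is divisible by [r] in the hull, hence, by purity, by an element [z] of the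
   completion. *)
have [|z /in_hullP[b /in_all_cosetsP bz] yz] := rd r _ hy.
  have /scaled_ideal_mulP[p [w [_ ->]]] := proj1 (in_all_cosetsP _ _) ay r x r0 ax.
  by exists (p *: w); rewrite scalerA.
have [v bv] := approx_ex hR hP b r0.
(* [z] differs from [iota v] by an element of [r Rhat], which [r] kills. *)
have rz : r *: z = iota (r *: (v : R^o)).
  have /scaled_ideal_mulP[p [w [_ e]]] := bz r v r0 bv.
  apply/eqP; rewrite linearZZ -subr_eq0 -scalerBr e scalerA mulrA rr mul0r.
  by rewrite scale0r.
exists (r *: (v : R^o) + x); apply/esym/in_all_cosets_iota.
by rewrite linearD -rz -yz subrK.
Qed.

End NotCogenerated.

End PureInjectiveHull.

(** A generator [t] of a simple ideal satisfies [t P = 0], so the topology is discrete and the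
    coordinate at [t P] determines [a]. *)
Lemma cogenerated_complete (R : comNzRingType) (P : ideal R) (hR : chain_ring R)
  (hP : maximal_ideal P) : finitely_cogenerated R^o -> fc_complete R^o.
Proof.
move=> fc a; have [|t t0 tP] := finitely_cogenerated_socle fc.
  by exists 1; apply: oner_neq0.
have tP0 x : scaled_ideal P t x -> x = 0.
  move=> [p Pp ->]; apply/eqP; apply: contrapT => /negP tp0.
  have [|b bpt] := tP p; first by rewrite -[_ *: _]/(p * t) mulrC.
  have : scaled_ideal P t t.
    exists (b * p); first exact: (rpredZ b Pp).
    by rewrite -{1}bpt mulrC -[_ *: _]/(b * (p * t)) mulrA.
  by move=> /(scaled_self hR hP) e; rewrite e eqxx in t0.
have [x ax] := approx_ex hR hP (a : Rtilde R) t0; exists x.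
apply: (approx_ext hR hP) => s s0; exists x; first exact: (@approx_rconst R P x s).
have [r r0 [[u rE] [v rE']]] := common_multiple hR t0 s0.
have [y ay] := approx_ex hR hP (a : Rtilde R) r0.
have <- : y = x.
  apply/eqP; rewrite -subr_eq0; apply/eqP/tP0; apply: (approx_uniq hR hP t0 _ ax).
  by rewrite rE in r0 ay; apply: (approx_mono hR hP r0 ay).
by rewrite rE' in r0 ay; apply: (approx_mono hR hP r0 ay).
Qed.

Theorem theorem1p3 (R : comNzRingType) (P : ideal R)
    (hR : chain_ring R) (hP : maximal_ideal P) :
  gaussian_local_ring (Rtilde R) /\
  (forall (Rhat : lmodType R) (iota : {linear R^o -> Rhat}),
     pure_injective_hull iota ->
     [<-> chain_ring (Rtilde R);
          fc_complete R^o \/ GRing.integral_domain_axiom R;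
          pure_submodule (Rtilde_in_hull P iota);
          flat (Rtilde R)]).
Proof.
split.
  apply: square_dominates_gaussian; first exact: Rtilde_local hP.
  exact: Rtilde_square_dominates hP.
move=> Rhat iota hull.
have bd : fc_complete R^o \/ GRing.integral_domain_axiom R -> flat (Rtilde R).
  by case; [apply: complete_flat hP|apply: domain_flat hP].
have ba : fc_complete R^o \/ GRing.integral_domain_axiom R -> chain_ring (Rtilde R).
  case=> [comp|dom]; apply: divisibility_total_chain.
    exact: complete_divisibility_total hP comp.
  exact: domain_divisibility_total hP dom.
have bc : fc_complete R^o \/ GRing.integral_domain_axiom R <->
    pure_submodule (Rtilde_in_hull P iota).
  have [fc|nfc] := pselect (finitely_cogenerated R^o); last first.
    split; first exact: (hull_pure hR hP hull nfc).
    exact: (pure_complete_or_domain hR hP hull nfc).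
  (* When [R] is finitely cogenerated both conditions hold: [R] is complete, and its completion is
     its image in the hull, which is pure. *)
  split=> _; last by left; apply: (cogenerated_complete hR hP fc).
  apply: (relatively_divisible_pure (chain_divisibility_total hR)) => s y.
  have inE z : z \in Rtilde_in_hull P iota <-> z \in linear_range iota.
    split=> [/asboolP[[_ //]|[//]]|zi]; by apply/asboolP; left.
  have [_ /pure_relatively_divisible pI _ _] := hull.
  move=> /inE yi ys; have [z /inE zi yE] := pI s y yi ys.
  by exists z.
tfae.
- by move=> /chain_divisibility_total; apply: chain_complete_or_domain hP.
- by case: bc.
- by move=> /bc/bd.
- by move=> fl; apply: ba; apply: flat_complete_or_domain hP fl.
Qed.
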